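(* Let $q$ be a prime power, $\mu=(\mu_1,\dots,\mu_\ell)$ a composition of $n$, and $N_\mu$, $M_\mu$, $a\mapsto v_a$ as in the context, with $a_v\in M_\mu$ denoting the unique matrix with $v_{a_v}=v$. For $a\in M_\mu$ let $P(a)=(P(a^{(f)}))_{f\in\Phi}$ and $Q(a)=(Q(a^{(f)}))_{f\in\Phi}$. Then the map $$v\longmapsto (P(a_v),Q(a_v))$$ is a bijection from $N_\mu$ onto the set of pairs $(P,Q)$ of $\Phi$-column strict tableaux of the same shape, both of weight $\mu$.
   Context: $G=\mathrm{GL}_n(\mathbb{F}_q)$, $U$ the upper unitriangular subgroup, $x_{ij}(t)$ the identity with $t$ added at $(i,j)$, $\psi$ a fixed nontrivial character of $(\mathbb{F}_q,+)$, $B_\mu=\{\mu_1,\mu_1+\mu_2,\dots,n\}$, and $\psi_\mu:U\to\mathbb{C}^*$ the linear character with $\psi_\mu(x_{i,i+1}(t))=\psi(t)$ if $i\notin B_\mu$ and $\psi_\mu(x_{ij}(t))=1$ for all other $i<j$. $N_\mu$ is the set of monomial matrices $v\in G$ such that $u\in U$, $vuv^{-1}\in U$ imply $\psi_\mu(u)=\psi_\mu(vuv^{-1})$. $M_\mu$ is the set of $\ell\times\ell$ matrices of monic polynomials $a_{ij}\in\mathbb{F}_q[X]$ with $a_{ij}(0)\ne0$, $\sum_j\deg a_{ij}=\mu_i$ for all $i$ and $\sum_i\deg a_{ij}=\mu_j$ for all $j$. For $a\in M_\mu$, $v_a$ is the $n\times n$ matrix built as follows: $w_{(k)}$ is the $k\times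 k$ antidiagonal permutation matrix; for monic $f=a_0+a_1X^{i_1}+\dots+a_rX^{i_r}+X^m$ ($0<i_1<\dots<i_r<m$, all $a_s\ne0$), $v_{(f)}=w_{(m)}(a_0w_{(i_1)}\oplus a_1w_{(i_2-i_1)}\oplus\dots\oplus a_rw_{(m-i_r)})$, and $v_{(1)}$ is empty; with $R_i=\mu_1+\dots+\mu_{i-1}$, $d_{ij}=\deg a_{ij}$, the block $v_{(a_{ij})}$ occupies rows $R_i+\sum_{k>j}d_{ik}+1,\dots,R_i+\sum_{k\ge j}d_{ik}$ and columns $R_j+\sum_{k>i}d_{kj}+1,\dots,R_j+\sum_{k\ge i}d_{kj}$, all other entries being $0$. The map $a\mapsto v_a$ is a bijection $M_\mu\to N_\mu$. $\Phi$ is the set of monic irreducible polynomials $f\in\mathbb{F}_q[X]$ with $f(0)\ne0$; $d(f)=\deg f$. For $a\in M_\mu$ and $f\in\Phi$, $a^{(f)}$ is the $\ell\times\ell$ nonnegative integer matrix with $a^{(f)}_{ij}$ the exponent of the highest power of $f$ dividing $a_{ij}$. Classical RSK (column insertion): for a column strict tableau $P$ and $j\ge1$, $P\leftarrow j$ inserts $j$ into the first column by displacing the smallest entry $\ge j$ (or placing $j$ at the bottom of the column if all entries are $<j$), then inserts the displaced entry into the next column, and so on until nothing is displaced. For $b\in M_\ell(\mathbb{Z}_{\ge0})$ let $\binom{i_1\ \cdots\ i_m}{j_1\ \cdots\ j_m}$ be the two-line array containing $b_{ij}$ copies of $\binom{i}{j}$, with $i_1\le\dots\le i_m$ and $j_k\ge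 j_{k+1}$ whenever $i_k=i_{k+1}$. Starting from $(\emptyset,\emptyset)$, set $P_k=P_{k-1}\leftarrow j_k$ and let $Q_k$ be $Q_{k-1}$ with $i_k$ placed in the new box of $\mathrm{sh}(P_k)$; $(P(b),Q(b))=(P_m,Q_m)$. A $\Phi$-column strict tableau $P=(P^{(f)})_{f\in\Phi}$ is a family of column strict tableaux, almost all empty; its shape is $(\mathrm{sh}(P^{(f)}))_f$, and its weight is the sequence $\mathrm{wt}(P)_i=\sum_f d(f)\cdot(\text{number of entries } i\text{ in }P^{(f)})$. *)

(* Defs.v *)
(* Rows, columns, parts of mu and tableau entries are numbered from 0. *)
From HB Require Import structures.
From mathcomp Require Import all_boot all_order all_algebra.
From mathcomp Require Import boolp classical_sets functions cardinality fsbigop.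

Set Implicit Arguments.
Unset Strict Implicit.
Unset Printing Implicit Defensive.

Import Order.TTheory GRing.Theory Num.Theory.
Local Open Scope ring_scope.
Local Open Scope classical_set_scope.

Definition is_composition (n : nat) (mu : seq nat) : Prop :=
  all (fun k => 0 < k)%N mu /\ sumn mu = n.

Definition partial_sums (mu : seq nat) : seq nat := scanl addn 0%N mu.

Section Characters.
Variables (F : finFieldType) (C : numClosedFieldType) (n : nat).

(* A character of (F, +). *)
Definition is_additive_character (psi : F -> C) : Prop :=
  (forall t, psi t != 0) /\ (forall s t, psi (s + t) = psi s * psi t).

Definition unitriangular (u : 'M[F]_n) : Prop :=
  forall i j : 'I_n, (j <= i)%N -> u i j = (i == j)%:R.

Definition root_elt (i j : 'I_n) (t : F) : 'M[F]_n := 1%:M + t *: delta_mx i j.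

(* psi_mu is determined by these conditions, as the root elements generate U;
   the index i : 'I_n denotes the (i.+1)-st row. *)
Record is_psi_mu (psi : F -> C) (mu : seq nat) (psi_mu : 'M[F]_n -> C) : Prop :=
  IsPsiMu {
    psi_mu_neq0 : forall u, unitriangular u -> psi_mu u != 0;
    psi_muM : forall u u', unitriangular u -> unitriangular u' ->
      psi_mu (u *m u') = psi_mu u * psi_mu u';
    psi_mu_root : forall (i j : 'I_n) (t : F), (i < j)%N ->
      psi_mu (root_elt i j t) =
        if (j == i.+1 :> nat) && (i.+1 \notin partial_sums mu) then psi t else 1
  }.

Definition monomial_mx (v : 'M[F]_n) : Prop :=
  (forall i, exists! j, v i j != 0) /\ (forall j, exists! i, v i j != 0).

Definition N_mu (psi_mu : 'M[F]_n -> C) : set 'M[F]_n :=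
  [set v | [/\ v \in unitmx, monomial_mx v
    & forall u, unitriangular u -> unitriangular (v *m u *m invmx v) ->
        psi_mu u = psi_mu (v *m u *m invmx v)]].

End Characters.

Section PolynomialMatrices.
Variable F : finFieldType.

Definition pdeg (f : {poly F}) : nat := (size f).-1.

Definition M_mu (l : nat) (mu : l.-tuple nat) : set 'M[{poly F}]_l :=
  [set a | [/\ forall i j, a i j \is monic,
               forall i j, (a i j).[0] != 0,
               forall i, (\sum_j pdeg (a i j))%N = tnth mu i
             & forall j, (\sum_i pdeg (a i j))%N = tnth mu j]].

Definition antidiag (k : nat) : 'M[F]_k := \matrix_(i, j) (i + j == k.-1)%N%:R.

(* c_0 w_(k_0) (+) c_1 w_(k_1) (+) ... for s = [:: (c_0, k_0); (c_1, k_1); ...]. *)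
Fixpoint dsum_antidiag (s : seq (F * nat)) : 'M[F]_(sumn (unzip2 s)) :=
  match s return 'M[F]_(sumn (unzip2 s)) with
  | [::] => 0
  | x :: s' => block_mx (x.1 *: antidiag x.2) 0 0 (dsum_antidiag s')
  end.

(* [:: (a_0, i_1); (a_1, i_2 - i_1); ...; (a_r, m - i_r)] when
   f = a_0 + a_1 X^{i_1} + ... + a_r X^{i_r} + X^m and a_0 != 0;
   the second components then sum to m. *)
Definition poly_gaps (f : {poly F}) : seq (F * nat) :=
  let m := pdeg f in
  let e := [seq k <- iota 0 m | f`_k != 0] in
  [seq (f`_x.1, (x.2 - x.1)%N) | x <- zip e (behead (rcons e m))].

(* conform_mx only casts the dimension sumn (unzip2 (poly_gaps f)) to pdeg f. *)
Definition v_poly (f : {poly F}) : 'M[F]_(pdeg f) :=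
  antidiag (pdeg f) *m conform_mx 0 (dsum_antidiag (poly_gaps f)).

Section VMatrix.
Variables (n l : nat) (mu : l.-tuple nat) (a : 'M[{poly F}]_l).

Definition row_offset (i j : 'I_l) : nat :=
  (\sum_(k < l | k < i) tnth mu k + \sum_(k < l | j < k) pdeg (a i k))%N.

Definition col_offset (i j : 'I_l) : nat :=
  (\sum_(k < l | k < j) tnth mu k + \sum_(k < l | i < k) pdeg (a k j))%N.

(* Entry (p, q) of the block v_poly (a i j) goes to position
   (row_offset i j + p, col_offset i j + q).  The blocks do not overlap for a
   in M_mu, so that the sum has at most one nonempty term at each (r, c). *)
Definition v_mx : 'M[F]_n :=
  \matrix_(r, c) \sum_i \sum_j
    \sum_(p < pdeg (a i j) | r == row_offset i j + p :> nat)
    \sum_(q < pdeg (a i j) | c == col_offset i j + q :> nat)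
      v_poly (a i j) p q.

End VMatrix.

(* The matrix a_v in M_mu such that v_{a_v} = v. *)
Definition a_of (n l : nat) (mu : l.-tuple nat) (v : 'M[F]_n) : 'M[{poly F}]_l :=
  xget 0 [set a | M_mu mu a /\ v_mx n mu a = v].

Definition Phi : set {poly F} :=
  [set f | [/\ f \is monic, irreducible_poly f & f.[0] != 0]].

(* Exponent of the highest power of f dividing p, for nonconstant f and p != 0
   (these imply that this exponent is < size p). *)
Definition pmult (f p : {poly F}) : nat :=
  (\max_(k < size p | (f ^+ k %| p)%R) k)%N.

Definition mult_mx (l : nat) (a : 'M[{poly F}]_l) (f : {poly F}) : 'M[nat]_l :=
  \matrix_(i, j) pmult f (a i j).

End PolynomialMatrices.

Arguments Phi F : clear implicits.

(* A tableau is the list of its columns, from left to right, each read from top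
   to bottom.  The shape, a Young diagram, is thus given by its column lengths,
   i.e. by seq.shape. *)
Definition tableau := seq (seq nat).

(* Columns strictly increase.  Since all2 compares sizes, the last condition says
   that column lengths weakly decrease and that rows weakly increase. *)
Definition column_strict (T : tableau) : bool :=
  [&& [::] \notin T, all (sorted ltn) T
    & sorted (fun c d : seq nat => all2 leq (take (size d) c) d) T].

(* T <- j.  In a strictly increasing column c the smallest entry >= j is the first
   one; its index is k, which is size c if there is none. *)
Fixpoint col_insert (T : tableau) (j : nat) : tableau :=
  if T is c :: T' then
    let k := find (leq j) c in
    set_nth 0%N c k j ::
      (if (k < size c)%N then col_insert T' (nth 0%N c k) else T')
  else [:: [:: j]].

(* Add i at the bottom of the first column of T shorter than prescribed by s. *)
Definition place (s : seq nat) (T : tableau) (i : nat) : tableau :=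
  let c := find (fun k => nth 0%N (shape T) k < nth 0%N s k)%N (iota 0 (size s)) in
  set_nth [::] T c (rcons (nth [::] T c) i).

Definition two_line_array (l : nat) (b : 'M[nat]_l) : seq (nat * nat) :=
  flatten [seq nseq (b i j) (nat_of_ord i, nat_of_ord j)
            | i <- enum 'I_l, j <- rev (enum 'I_l)].

Definition rsk_step (PQ : tableau * tableau) (ij : nat * nat) : tableau * tableau :=
  let P' := col_insert PQ.1 ij.2 in (P', place (shape P') PQ.2 ij.1).

Definition rsk (l : nat) (b : 'M[nat]_l) : tableau * tableau :=
  foldl rsk_step ([::], [::]) (two_line_array b).

Section PhiTableaux.
Variable F : finFieldType.

Definition Phi_family := Phi F -> tableau.

Definition Phi_column_strict (P : Phi_family) : Prop :=
  (forall f, column_strict (P f)) /\ finite_set [set f | P f != [::]].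

Definition same_shape (P Q : Phi_family) : Prop :=
  forall f, shape (P f) = shape (Q f).

Definition weight (P : Phi_family) (i : nat) : nat :=
  (\big[addn/0]_(f \in [set: Phi F])
     (pdeg (val f) * count_mem i (flatten (P f))))%N.

(* The weight is a sequence indexed by all of nat: parts of mu beyond its length
   are 0. *)
Definition has_weight (P : Phi_family) (mu : seq nat) : Prop :=
  forall i, weight P i = nth 0%N mu i.

Definition P_Phi (l : nat) (a : 'M[{poly F}]_l) : Phi_family :=
  fun f => (rsk (mult_mx a (val f))).1.

Definition Q_Phi (l : nat) (a : 'M[{poly F}]_l) : Phi_family :=
  fun f => (rsk (mult_mx a (val f))).2.

Definition tableau_pairs (mu : seq nat) : set (Phi_family * Phi_family) :=
  [set PQ | [/\ Phi_column_strict PQ.1, Phi_column_strict PQ.2,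
                same_shape PQ.1 PQ.2, has_weight PQ.1 mu & has_weight PQ.2 mu]].

End PhiTableaux.

Arguments tableau_pairs F mu : clear implicits.

(* Main.v *)
Require Import Defs.
From mathcomp Require Import all_boot all_order all_algebra.
From mathcomp Require Import boolp classical_sets functions cardinality fsbigop.
From mathcomp Require Import zify.

(** A monomial matrix with the permutation w of the columns lies in N_mu if and only
if w and its inverse map pairs (c, c+1) inside a block of mu, when they are not
reversed, to pairs of the same kind, with equal nonzero entries in both columns;
this comes from testing psi_mu on the root elements x_ij(t), which generate U.
Hence w sends the columns of each block to weakly decreasing blocks of rows, and
likewise for its inverse, so that the matrix splits into ell x ell square blocks, in
each of which w is a decreasing sequence of runs of consecutive integers. The run
lengths and the values on the runs are the gaps and the coefficients of a monic
polynomial with nonzero constant term, which gives M_mu. Unique factorization turns a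
matrix in M_mu into a finitely supported family of nonnegative integer matrices
indexed by Phi, and RSK is applied to each of these. RSK is inverted one letter at a
time: the last letter of the array corresponds to the rightmost box of Q with the
largest entry, and column insertion can be undone from the box which it created. *)

Set Implicit Arguments.
Unset Strict Implicit.
Unset Printing Implicit Defensive.

Import GRing.Theory.

(** * Column insertion and RSK *)

(** The nonzero entry of column q of v_(f) depends only on the consecutive exponents e <= q < e' of
    f around q: the factor w_(m) turns the antidiagonal pieces into increasing runs, the run [e, e')
    filling the rows from m - e' to m - e - 1. Here f(0) != 0 makes the first run begin at column 0,
    and monicity makes the last one end at m. The matrix shows only the sum e + e' and the
    coefficient at e, which still determine f because the sum grows from one run to the next. The
    offsets of the blocks depend on all degrees at once, so a block can be located only after the
    degrees have been recovered from the matrix, by counting columns according to the parts of mu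
    that contain them and their nonzero entries. In RSK, the rule j_k >= j_{k+1} for equal i_k is
    what sends equal letters of the first row to columns further and further right; the converse
    comparison of two insertions shows that the inverse procedure yields a word obeying this
    rule. *)

Definition row_le (c d : seq nat) : bool := all2 leq (take (size d) c) d.

Lemma row_leP c d :
  reflect (size d <= size c /\ forall r, r < size d -> nth 0 c r <= nth 0 d r)
          (row_le c d).
Proof.
apply: (iffP idP); rewrite /row_le.
  rewrite all2E size_take => /andP[sz al].
  have le_dc : size d <= size c by move: sz; case: ltnP => //; lia.
  split=> // r ltr; move/(all_nthP (0, 0)): al => /(_ r).
  rewrite size_zip size_takel // minnn => /(_ ltr).
  by rewrite nth_zip ?size_takel //= nth_take.
case=> le_dc H; rewrite all2E size_takel // eqxx /=.
apply/(all_nthP (0, 0)) => r; rewrite size_zip size_takel // minnn => ltr.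
by rewrite nth_zip ?size_takel //= nth_take // H.
Qed.

Lemma column_strict_cons c T :
  column_strict (c :: T) =
  [&& c != [::], sorted ltn c, column_strict T & row_le c (head [::] T)].
Proof.
rewrite /column_strict inE negb_or /= (eq_sym [::] c).
case: T => [|d T] /=; first by rewrite /row_le; case: c => //= x c; rewrite !andbT.
by rewrite -/(row_le c d) -!andbA; do !bool_congr; rewrite andbC -!andbA; do !bool_congr.
Qed.

Lemma sorted_ltn_nthP c :
  reflect (forall a b, a < b < size c -> nth 0 c a < nth 0 c b) (sorted ltn c).
Proof.
apply: (iffP idP) => [so a b /andP[ab bc]|H].
  by apply: (sorted_ltn_nth ltn_trans) => //; rewrite inE //; lia.
by apply/(sortedP 0) => i ic; apply: H; rewrite ltnSn.
Qed.

Lemma find_leqP c j :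
  [/\ find (leq j) c <= size c,
      forall r, r < find (leq j) c -> nth 0 c r < j &
      find (leq j) c < size c -> j <= nth 0 c (find (leq j) c)].
Proof.
split=> [|r /(before_find 0)/negbT|]; first exact: find_size.
  by rewrite -ltnNge.
by rewrite -has_find => /(nth_find 0).
Qed.

(** The column in which the insertion of [j] creates its box; the insertion can be undone only when
    this column is known. *)
Fixpoint bump_col (T : tableau) (j : nat) : nat :=
  if T is c :: T' then
    let k := find (leq j) c in
    if k < size c then (bump_col T' (nth 0 c k)).+1 else 0
  else 0.

Lemma head_col_insert T j :
  head [::] (col_insert T j) =
  set_nth 0 (head [::] T) (find (leq j) (head [::] T)) j.
Proof. by case: T. Qed.

Lemma sorted_set_find c j :
  sorted ltn c -> sorted ltn (set_nth 0 c (find (leq j) c) j).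
Proof.
move=> /sorted_ltn_nthP so; have [k1 k2 k3] := find_leqP c j.
apply/sorted_ltn_nthP => a b; rewrite size_set_nth !nth_set_nth /=.
set k := find _ _ in k1 k2 k3 *; move=> H.
case: (eqVneq a k) => [ea|nak]; case: (eqVneq b k) => [eb|nbk]; try lia.
- have kc : k < size c by lia.
  by apply: leq_ltn_trans (k3 kc) _; apply: so; lia.
- by apply: k2; lia.
- by apply: so; lia.
Qed.

Lemma column_strict_insert T j : column_strict T -> column_strict (col_insert T j).
Proof.
elim: T j => [|c T IH] j //.
rewrite column_strict_cons => /and4P[c0 so csT rl].
have [k1 k2 k3] := find_leqP c j.
rewrite [col_insert _ _]/=; set k := find (leq j) c in k1 k2 k3 *.
have d0 : set_nth 0 c k j != [::] by rewrite -size_eq0 size_set_nth; lia.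
have sd : sorted ltn (set_nth 0 c k j) by apply: sorted_set_find.
move/row_leP: rl => [szT rT].
case: ifP => kc; rewrite column_strict_cons d0 sd /=.
  rewrite IH //=; rewrite head_col_insert; apply/row_leP.
  set e := head [::] T in szT rT *; set y := nth 0 c k.
  have [h1 h2 h3] := find_leqP e y; set k0 := find _ _ in h1 h2 h3 *.
  (* A displaced entry never moves down: an entry of the next column in row [k] is at least [y], so
     [y] goes to row [k] or above. *)
  have k0k : k0 <= k.
    rewrite leqNgt; apply/negP => lt; have := h2 _ lt.
    have ke : k < size e by lia.
    by have := rT _ ke; rewrite -/y; lia.
  rewrite !size_set_nth; split; first lia.
  move=> r rs; rewrite !nth_set_nth /=.
  have jy := k3 kc; rewrite -/y in jy.
  move/sorted_ltn_nthP in so.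
  case: (eqVneq r k) => [rk|nrk]; case: (eqVneq r k0) => [rk0|nrk0] //.
  - by have := rT r; rewrite rk -/y; lia.
  - by have := k2 r; lia.
  - by apply: rT; lia.
rewrite csT; apply/row_leP; rewrite size_set_nth; split; first lia.
move=> r rs; rewrite nth_set_nth /=; case: eqP => [|_]; last exact: rT.
by move=> rk; have := k1; lia.
Qed.

Lemma shape_col_insert T j :
  shape (col_insert T j) = incr_nth (shape T) (bump_col T j).
Proof.
elim: T j => [|c T IH] j //=; have [k1 _ _] := find_leqP c j.
case: ifP => kc /=; rewrite ?IH size_set_nth; congr (_ :: _); lia.
Qed.

Lemma bump_col_le T j : bump_col T j <= size T.
Proof. by elim: T j => //= c T IH j; case: ifP => // _; rewrite ltnS. Qed.

(** In each column the second insertion acts weakly above the first and displaces an entry that is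
    at most the one displaced before; in the column where the first ends, it still displaces
    something. *)
Lemma bump_col_lt T j j' : all (sorted ltn) T ->
  j' <= j -> bump_col T j < bump_col (col_insert T j) j'.
Proof.
elim: T j j' => [|c T IH] j j' /=; first by move=> _ ->.
move=> /andP[so soT] le; have [k1 k2 k3] := find_leqP c j.
set k := find (leq j) c in k1 k2 k3 *; set d := set_nth 0 c k j.
have [h1 h2 h3] := find_leqP d j'; set k' := find _ _ in h1 h2 h3 *.
have dk : nth 0 d k = j by rewrite nth_set_nth /= eqxx.
have szd : size d = maxn k.+1 (size c) by rewrite size_set_nth.
have k'k : k' <= k by rewrite leqNgt; apply/negP => /h2; lia.
rewrite (_ : k' < size d); last by lia.
case: ifP => // kc; rewrite ltnS; apply: IH => //.
have := k3 kc; rewrite nth_set_nth /=; case: (eqVneq k' k) => [|nk]; first lia.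
by have := k2 k'; lia.
Qed.

(** Here the second insertion acts strictly below the first and displaces a larger entry, so it ends
    no later. *)
Lemma bump_col_ge T j j' : all (sorted ltn) T ->
  j < j' -> bump_col (col_insert T j) j' <= bump_col T j.
Proof.
elim: T j j' => [|c T IH] j j' /=; first by rewrite ltnNge => _ /negbTE ->.
move=> /andP[so soT] lt; have [k1 k2 k3] := find_leqP c j.
have sd := sorted_set_find j so.
set k := find (leq j) c in k1 k2 k3 sd *; set d := set_nth 0 c k j in sd *.
have [h1 h2 h3] := find_leqP d j'; set k' := find _ _ in h1 h2 h3 *.
have dk : nth 0 d k = j by rewrite nth_set_nth /= eqxx.
have szd : size d = maxn k.+1 (size c) by rewrite size_set_nth.
case: ifP => // k'd; have jk' := h3 k'd.
have kk' : k < k'.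
  rewrite ltnNge; apply/negP => le; have [e|ne] := eqVneq k' k.
    by move: jk'; rewrite e dk; lia.
  by move/sorted_ltn_nthP: sd => /(_ k' k); lia.
rewrite (_ : k < size c); last by lia.
rewrite ltnS; apply: IH => //; rewrite nth_set_nth /=.
rewrite (_ : k' == k = false); last by lia.
by move/sorted_ltn_nthP: so; apply; lia.
Qed.

Lemma column_strict_sorted T : column_strict T -> all (sorted ltn) T.
Proof. by case/and3P. Qed.

Lemma column_strict_nil T : column_strict T -> [::] \notin T.
Proof. by case/and3P. Qed.

(** The same tableau can arise by creating any of its corners, hence the hypothesis on [bump_col].
    It tells at each column whether an entry was displaced, and the displaced entry is known from
    the columns on the right, by induction. *)
Lemma col_insert_inj T1 T2 j1 j2 : column_strict T1 -> column_strict T2 ->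
  col_insert T1 j1 = col_insert T2 j2 -> bump_col T1 j1 = bump_col T2 j2 ->
  T1 = T2 /\ j1 = j2.
Proof.
have nilcase c T j j' : column_strict (c :: T) -> bump_col (c :: T) j = 0 ->
    col_insert (c :: T) j = [:: [:: j']] -> False.
  rewrite column_strict_cons => /and4P[c0 _ _ _] /=; have [k1 _ _] := find_leqP c j.
  case: ifP => // kc _ [/(congr1 size)]; rewrite size_set_nth /=.
  move=> sz _; have : 0 < size c by [case: (c) c0].
  by lia.
elim: T1 T2 j1 j2 => [|c1 T1 IH] [|c2 T2] j1 j2 cs1 cs2.
- by move=> [->].
- by move=> e /esym b; case: (nilcase _ _ _ _ cs2 b (esym e)).
- by move=> e b; case: (nilcase _ _ _ _ cs1 b e).
move: cs1 cs2; rewrite !column_strict_cons => /and4P[n1 so1 cs1 _] /and4P[n2 so2 cs2 _].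
move=> [/=]; have [k1 k2 k3] := find_leqP c1 j1; have [h1 h2 h3] := find_leqP c2 j2.
set k := find (leq j1) c1 in k1 k2 k3 *; set h := find (leq j2) c2 in h1 h2 h3 *.
case: ifP => kc; case: ifP => hc // ed eT; last first.
  have kE : k = size c1 by lia.
  have hE : h = size c2 by lia.
  move: ed; rewrite eT => ed _.
  have es : size c1 = size c2.
    by move/(congr1 size): ed; rewrite !size_set_nth; lia.
  have ec : c1 = c2.
    apply: (@eq_from_nth _ 0) => // r rc; move/(congr1 (nth 0 ^~ r)): ed.
    rewrite !nth_set_nth /=.
    have -> : (r == k) = false by lia.
    by have -> : (r == h) = false by lia.
  split; first by rewrite ec.
  move/(congr1 (nth 0 ^~ k)): ed; rewrite !nth_set_nth /= eqxx.
  by have -> : (k == h) by lia.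
case=> eb; have [eT2 ey] := IH _ _ _ cs1 cs2 eT eb.
have es : size c1 = size c2.
  by move/(congr1 size): ed; rewrite !size_set_nth; lia.
have en r : (if r == k then j1 else nth 0 c1 r) = (if r == h then j2 else nth 0 c2 r).
  by move/(congr1 (nth 0 ^~ r)): ed; rewrite !nth_set_nth.
(* If k < h, then row h gives c1_h = j2 <= y, where y is the common displaced entry, whereas c1
   increases and has y in row k. The other case is symmetric. *)
have kh : k = h.
  move/sorted_ltn_nthP in so1; move/sorted_ltn_nthP in so2.
  have j1y := k3 kc; have j2y := h3 hc.
  have [lt|gt|//] := ltngtP k h.
    have := en h; rewrite eqxx (_ : h == k = false); last by lia.
    by have := so1 k h; lia.
  have := en k; rewrite eqxx (_ : k == h = false); last by lia.
  by have := so2 h k; lia.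
have ej : j1 = j2 by have := en k; rewrite eqxx kh eqxx.
split=> //; rewrite eT2; congr (_ :: _); apply: (@eq_from_nth _ 0) => // r rc.
by have := en r; rewrite -kh; case: eqP => [->|//]; rewrite ey kh.
Qed.

(** The second hypothesis says that column [b] ends in a corner. The insertion is undone from there
    to the left, each column handing back the entry that its left neighbour had displaced. *)
Lemma col_insert_surj P b : column_strict P ->
  size (nth [::] P b.+1) < size (nth [::] P b) ->
  exists T j, [/\ column_strict T, col_insert T j = P & bump_col T j = b].
Proof.
elim: P b => [|d P IH] b; first by rewrite !nth_nil.
rewrite column_strict_cons => /and4P[d0 so cs rl].
case: b => [|b] /=; rewrite ?nth0 => szb.
  case/lastP: d => [|c j] // in d0 so rl szb *.
  have [le rlP] := row_leP _ _ rl; rewrite size_rcons ltnS in szb.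
  have alj : forall r, r < size c -> nth 0 c r < j.
    move=> r rc; move/sorted_ltn_nthP: so => /(_ r (size c)).
    by rewrite !nth_rcons rc ltnn eqxx size_rcons; apply; lia.
  have nohas : ~~ has (leq j) c.
    by apply/hasPn => x /(nthP 0)[r rc <-]; rewrite -ltnNge; apply: alj.
  have fE : find (leq j) c = size c by rewrite hasNfind.
  have eqr : set_nth 0 c (size c) j = rcons c j.
    elim: {alj nohas fE le rlP szb so rl d0} c => //= x c IHc.
    by congr (_ :: _); exact: IHc.
  case: (eqVneq c [::]) => [c0|c0].
    exists [::], j; move: szb cs; rewrite c0 /=.
    case: P {IH rl le rlP} => //= -[|//] T _.
    by rewrite column_strict_cons.
  exists (c :: P), j; rewrite /= fE ltnn eqr; split=> //.
  rewrite column_strict_cons c0 cs /=; apply/andP; split.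
    apply/sorted_ltn_nthP => a b ab; move/sorted_ltn_nthP: so => /(_ a b).
    rewrite size_rcons !nth_rcons (_ : a < size c); last by lia.
    by rewrite (_ : b < size c); [apply; lia | lia].
  apply/row_leP; split=> // r rP; have := rlP r rP.
  by rewrite nth_rcons (_ : r < size c) //; lia.
have [T0 [y [csT insT bT]]] := IH b cs szb.
move/row_leP: rl; rewrite -insT head_col_insert size_set_nth.
set e := head [::] T0; have [h1 h2 h3] := find_leqP e y.
set k0 := find _ _ in h1 h2 h3 *; move=> [sz rl].
(* After the insertion [y] sits in row [k0] of the next column, so the row condition provides an
   entry of [d] that is at most [y]. *)
have le0 : nth 0 d k0 <= y.
  by have := rl k0; rewrite nth_set_nth /= eqxx; apply; lia.
(* The entry that displaced [y] is the largest entry of [d] which is at most [y]. *)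
have ex : exists k, (k < size d) && (nth 0 d k <= y).
  by exists k0; rewrite le0 andbT; lia.
have ub k : (k < size d) && (nth 0 d k <= y) -> k <= size d by lia.
case: (ex_maxnP ex ub) => k /andP[kd ky] kmax.
have k0k : k0 <= k by apply: kmax; rewrite le0 andbT; lia.
have afterk r : k < r < size d -> y < nth 0 d r.
  by move=> H; rewrite ltnNge; apply/negP => ley; have := kmax r; lia.
move/sorted_ltn_nthP in so.
pose c := set_nth 0 d k y; pose j := nth 0 d k.
have szc : size c = size d by rewrite size_set_nth; lia.
have cE r : nth 0 c r = if r == k then y else nth 0 d r by rewrite nth_set_nth.
have fE : find (leq j) c = k.
  have [f1 f2 f3] := find_leqP c j; set f := find _ _ in f1 f2 f3 *.
  have [lt|gt|//] := ltngtP f k.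
    have := f3; rewrite cE (_ : f == k = false); last by lia.
    by have := so f k; rewrite -/j; lia.
  by have := f2 k gt; rewrite cE eqxx /j; lia.
exists (c :: T0), j; rewrite /= fE szc kd cE eqxx insT bT; split=> //.
- rewrite column_strict_cons csT -size_eq0 szc size_eq0 d0 /=; apply/andP; split.
    apply/sorted_ltn_nthP => a b'; rewrite szc !cE => ab.
    case: (eqVneq a k) => [ak|nak]; case: (eqVneq b' k) => [bk|nbk].
    + by lia.
    + by apply: afterk; lia.
    + by have := so a k; lia.
    + by apply: so.
  apply/row_leP; rewrite szc -/e; split; first by lia.
  move=> r re; rewrite cE; have := rl r; rewrite nth_set_nth /=.
  have e_so : sorted ltn e.
    by rewrite /e; case: (T0) csT => //= c0 T1; rewrite column_strict_cons => /and4P[].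
  move/sorted_ltn_nthP in e_so.
  case: (eqVneq r k) => [rk|nrk] H.
    rewrite rk in re *; have := h3 (leq_ltn_trans k0k re).
    case: (eqVneq k0 k) => [<- //|nk] ye; apply: leq_trans ye (ltnW _).
    by apply: e_so; lia.
  move: H; case: (eqVneq r k0) => [rk0|nrk0] H; last by apply: H; lia.
  by rewrite rk0 in re nrk H *; have := h3 re; lia.
- congr (_ :: _); apply: (@eq_from_nth _ 0).
    by rewrite size_set_nth szc; lia.
  by move=> r rc; rewrite nth_set_nth /= cE; case: eqP => // ->.
Qed.

(** * Adding and removing boxes of the recording tableau *)

Definition add_box (Q : tableau) (b i : nat) : tableau :=
  set_nth [::] Q b (rcons (nth [::] Q b) i).

Lemma add_box_cons0 c Q i : add_box (c :: Q) 0 i = rcons c i :: Q.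
Proof. by []. Qed.

Lemma add_box_consS c Q b i : add_box (c :: Q) b.+1 i = c :: add_box Q b i.
Proof. by []. Qed.

Lemma shape_add_box Q b i : shape (add_box Q b i) = incr_nth (shape Q) b.
Proof.
elim: Q b => [|c Q IH] [|b] //=.
- by rewrite /add_box /shape /=; congr (_ :: _); elim: b => //= b ->.
- by rewrite size_rcons.
- by rewrite -IH.
Qed.

(** The shapes differ in column [b] only, so the search made by [place] can be replaced by [add_box]
    at a known column. *)
Lemma place_incr Q s b i : shape Q = s -> b <= size s ->
  place (incr_nth s b) Q i = add_box Q b i.
Proof.
move=> <- bs; rewrite /place.
suff -> : find (fun k => nth 0 (shape Q) k < nth 0 (incr_nth (shape Q) b) k)
   (iota 0 (size (incr_nth (shape Q) b))) = b by [].
set p := fun k => _; set s' := size _.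
have bs' : b < s' by rewrite /s' size_incr_nth; case: ifP.
have pE k : p k = (k == b).
  by rewrite /p nth_incr_nth -[X in X < _]add0n ltn_add2r eq_sym; case: eqP.
rewrite (eq_find pE); have -> : iota 0 s' = iota 0 b ++ b :: iota b.+1 (s' - b.+1).
  by rewrite -[b :: _]/(iota b (s' - b.+1).+1) -iotaD; congr iota; lia.
by rewrite find_cat has_pred1 mem_iota add0n ltnn andbF size_iota /= eqxx addn0.
Qed.

Lemma perm_cat_cons (T : eqType) (s t : seq T) x :
  perm_eq (s ++ x :: t) (x :: s ++ t).
Proof. exact: permEl (perm_catCA s [:: x] t). Qed.

Lemma perm_add_box Q b i :
  perm_eq (flatten (add_box Q b i)) (i :: flatten Q).
Proof.
elim: Q b => [|c Q IH] [|b].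
- by [].
- by rewrite /add_box /=; elim: b.
- by rewrite add_box_cons0 /= cat_rcons perm_cat_cons.
- rewrite add_box_consS /=; apply: perm_trans (_ : perm_eq (c ++ i :: flatten Q) _).
    by rewrite perm_cat2l.
  exact: perm_cat_cons.
Qed.

Lemma perm_col_insert T j : perm_eq (flatten (col_insert T j)) (j :: flatten T).
Proof.
elim: T j => [|c T IH] j //=; have [k1 _ _] := find_leqP c j.
set k := find (leq j) c in k1 *.
case: ifP => kc /=; last first.
  have -> : set_nth 0 c k j = rcons c j.
    have -> : k = size c by lia.
    by elim: (c) => //= x d ->.
  by rewrite cat_rcons perm_cat_cons.
have -> : set_nth 0 c k j = take k c ++ j :: drop k.+1 c.
  by rewrite set_nthE kc.
set y := nth 0 c k.
have ec : c = take k c ++ y :: drop k.+1 c.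
  by rewrite -(drop_nth 0 kc) cat_take_drop.
rewrite [X in perm_eq _ (_ :: X ++ _)]ec.
rewrite -!catA !cat_cons (permPl (perm_cat_cons _ _ _)) perm_cons perm_cat2l.
apply: perm_trans (_ : perm_eq (drop k.+1 c ++ y :: flatten T) _).
  by rewrite perm_cat2l.
exact: perm_cat_cons.
Qed.

(** As [i] is at least every entry, only an [i] already in column [b] could break strictness, and
    the third hypothesis excludes it. The last one says that the box may be added to the diagram. *)
Lemma column_strict_add_box Q b i : column_strict Q ->
  all (leq^~ i) (flatten Q) -> (forall k, i \in nth [::] Q k -> k < b) ->
  b = 0 \/ size (nth [::] Q b) < size (nth [::] Q b.-1) ->
  column_strict (add_box Q b i).
Proof.
elim: Q b => [|c Q IH] b; first by rewrite !nth_nil => _ _ _ [->|//].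
rewrite column_strict_cons /= all_cat => /and4P[c0 so cs rl] /andP[ac aQ] ib.
case: b ib => [|b] ib ad.
  rewrite add_box_cons0 column_strict_cons cs -size_eq0 size_rcons /=.
  have alt : forall r, r < size c -> nth 0 c r < i.
    move=> r rc; have /(all_nthP 0)/(_ r rc) := ac; rewrite leq_eqVlt.
    by case: eqP => [e _|//]; have := ib 0; rewrite /= -e mem_nth // => /(_ isT).
  apply/andP; split.
    apply/sorted_ltn_nthP => a b; rewrite size_rcons !nth_rcons => ab.
    rewrite (_ : a < size c); last by lia.
    case: (ltnP b (size c)) => bc; first by move/sorted_ltn_nthP: so; apply; lia.
    by rewrite (_ : b == size c); [apply: alt|]; lia.
  move/row_leP: rl => [sz rl]; apply/row_leP; rewrite size_rcons; split; first lia.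
  by move=> r rQ; rewrite nth_rcons (_ : r < size c) ?rl //; lia.
rewrite add_box_consS column_strict_cons c0 so /=.
have adQ : b = 0 \/ size (nth [::] Q b) < size (nth [::] Q b.-1).
  by case: (b) ad => [|b'] [|] //=; [left|right].
rewrite IH //=; last by move=> k /(ib k.+1).
case: b {ib adQ} ad => [|b] ad.
  have -> : head [::] (add_box Q 0 i) = rcons (head [::] Q) i by case: (Q).
  case: ad => // /= ; rewrite nth0 => szQ.
  move/row_leP: rl => [sz rl]; apply/row_leP; rewrite size_rcons; split => // r.
  rewrite ltnS nth_rcons => rQ; case: (ltnP r (size (head [::] Q))) => rQ'.
    exact: rl.
  rewrite (_ : r == size (head [::] Q)); last by lia.
  by have /(all_nthP 0)-> := ac; lia.
have -> // : head [::] (add_box Q b.+1 i) = head [::] Q.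
by case: ad => //=; case: (Q) => //=; rewrite !nth_nil.
Qed.

(** The side conditions exclude empty columns and padding: with the default [[::]], an absent column
    and an empty one would give the same result. *)
Lemma add_box_inj Q1 Q2 b i : [::] \notin Q1 -> [::] \notin Q2 ->
  b <= size Q1 -> b <= size Q2 -> add_box Q1 b i = add_box Q2 b i -> Q1 = Q2.
Proof.
elim: b Q1 Q2 => [|b IH] [|c1 Q1] [|c2 Q2] //.
- by rewrite add_box_cons0 => _ + _ _ []; case: c2 => // x [].
- by rewrite add_box_cons0 => + _ _ _ []; case: c1 => // x [].
- by rewrite !add_box_cons0 => _ _ _ _ [e1 ->]; have [->] := rcons_inj e1.
rewrite !inE !negb_or !add_box_consS => /andP[_ n1] /andP[_ n2] b1 b2 [-> e].
by rewrite (IH _ _ n1 n2 b1 b2 e).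
Qed.

Lemma column_strict_size Q k : column_strict Q ->
  size (nth [::] Q k.+1) <= size (nth [::] Q k).
Proof.
elim: Q k => [|c Q IH] k; first by rewrite !nth_nil.
rewrite column_strict_cons => /and4P[_ _ cs /row_leP[sz _]].
by case: k => [|k] /=; [rewrite nth0|exact: IH].
Qed.

Lemma remove_box Q i : column_strict Q -> all (leq^~ i) (flatten Q) ->
  i \in flatten Q ->
  exists Q' b, [/\ column_strict Q', Q = add_box Q' b i, b <= size Q' &
    forall k, i \in nth [::] Q' k -> k < b].
Proof.
elim: Q => [|c Q IH] //.
rewrite column_strict_cons /= all_cat mem_cat => /and4P[c0 so cs rl] /andP[ac aQ].
(* The rightmost [i] is removed: it is looked for in [c] only when no later column contains [i], and
   is then the bottom entry of [c]. *)
have [iQ _|niQ] := boolP (i \in flatten Q).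
  have [Q' [b [cs' eQ bs ib]]] := IH cs aQ iQ.
  exists (c :: Q'), b.+1; rewrite add_box_consS -eQ; split=> //; last by case.
  rewrite column_strict_cons c0 so cs' /=.
  move/row_leP: rl => [sz rl]; move: sz rl.
  have -> : head [::] Q = if b == 0 then rcons (head [::] Q') i else head [::] Q'.
    by rewrite eQ; case: (Q') bs => [|d Q''] /=; case: (b).
  case: (b == 0) => sz rl; apply/row_leP; last by split.
  rewrite size_rcons in sz rl; split=> [|r rQ]; first by lia.
  by have := rl r; rewrite nth_rcons rQ; apply; lia.
rewrite orbF; case/lastP: c => [|c j] // in c0 so ac rl *.
rewrite mem_rcons inE => ic.
move: ac; rewrite all_rcons => /andP[ji ac].
have alj : forall r, r < size c -> nth 0 c r < j.
  move=> r rc; move/sorted_ltn_nthP: so => /(_ r (size c)).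
  by rewrite !nth_rcons rc ltnn eqxx size_rcons; apply; lia.
have {ic} ij : i = j.
  case/predU1P: ic => [//|/(nthP 0)[r rc e]].
  by have := alj r rc; rewrite e => ?; lia.
rewrite -{j}ij in alj c0 so rl ji *.
have nic : i \notin c.
  by apply/negP => /(nthP 0)[r rc e]; have := alj r rc; rewrite e ltnn.
have niQk k : i \notin nth [::] Q k.
  case: (ltnP k (size Q)) => kQ; last by rewrite nth_default.
  by apply: contra niQ => iQ; apply/flattenP; exists (nth [::] Q k); rewrite ?mem_nth.
move/row_leP: rl => [sz rl]; rewrite size_rcons in sz.
(* Otherwise the next column has an entry in the row of this [i]; it is at least [i], hence equal to
   [i], contrary to [niQ]. *)
have szQ : size (head [::] Q) <= size c.
  rewrite leqNgt; apply/negP => lt.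
  have := rl _ lt; rewrite nth_rcons ltnn eqxx => ge.
  have iin : nth 0 (head [::] Q) (size c) \in flatten Q.
    by case: (Q) lt => //= d Q' lt; rewrite mem_cat mem_nth.
  have /allP/(_ _ iin) le := aQ.
  by case/negP: niQ; rewrite (_ : i = nth 0 (head [::] Q) (size c)) //; lia.
have rlc : forall r, r < size (head [::] Q) -> nth 0 c r <= nth 0 (head [::] Q) r.
  by move=> r rQ; have := rl r rQ; rewrite nth_rcons (_ : r < size c) //; lia.
have soc : sorted ltn c.
  apply/sorted_ltn_nthP => a b ab; move/sorted_ltn_nthP: so => /(_ a b).
  rewrite size_rcons !nth_rcons (_ : a < size c); last by lia.
  by rewrite (_ : b < size c); [apply; lia | lia].
have [c0'|c0'] := eqVneq c [::].
  exists [::], 0; split=> //; last by move=> k; rewrite nth_nil.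
  rewrite c0' /= in szQ *; case: (Q) cs szQ => // d Q'.
  by rewrite column_strict_cons; case: d.
exists (c :: Q), 0; split=> //.
  by rewrite column_strict_cons c0' soc cs /=; apply/row_leP.
by case=> [|k] /=; [rewrite (negbTE nic)|rewrite (negbTE (niQk k))].
Qed.

(** * RSK on sorted words *)

Definition word_le (x y : nat * nat) : bool :=
  (x.1 < y.1) || (x.1 == y.1) && (y.2 <= x.2).

Lemma word_le_refl : reflexive word_le.
Proof. by move=> x; rewrite /word_le eqxx leqnn orbT. Qed.

Lemma word_le_trans : transitive word_le.
Proof. move=> [y1 y2] [x1 x2] [z1 z2]; rewrite /word_le /=; lia. Qed.

(** Antisymmetry makes a sorted word a function of the multiplicities of its letters, that is, of a
    matrix. *)
Lemma word_le_anti : antisymmetric word_le.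
Proof.
move=> [x1 x2] [y1 y2]; rewrite /word_le /= => H.
by have [-> ->] : x1 = y1 /\ x2 = y2 by lia.
Qed.

Lemma sorted_rcons2 (w : seq (nat * nat)) x y :
  sorted word_le (rcons (rcons w x) y) = sorted word_le (rcons w x) && word_le x y.
Proof. by case: w => [|z w] /=; rewrite ?andbT // rcons_path last_rcons. Qed.

Lemma sorted_rcons_prefix (w : seq (nat * nat)) y :
  sorted word_le (rcons w y) -> sorted word_le w.
Proof. by case: w => [|z w] //=; rewrite rcons_path => /andP[]. Qed.

Definition rsk_word (w : seq (nat * nat)) : tableau * tableau :=
  foldl rsk_step ([::], [::]) w.

Lemma rsk_word_rcons w x : rsk_word (rcons w x) = rsk_step (rsk_word w) x.
Proof. by rewrite /rsk_word foldl_rcons. Qed.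

Lemma rsk_step_add_box P Q x : shape P = shape Q ->
  rsk_step (P, Q) x = (col_insert P x.2, add_box Q (bump_col P x.2) x.1).
Proof.
move=> sh; rewrite /rsk_step /= shape_col_insert place_incr //.
by rewrite size_map bump_col_le.
Qed.

Lemma last_row_max w x : sorted word_le (rcons w x) ->
  all (leq^~ x.1) (unzip1 w).
Proof.
elim/last_ind: w x => [|w y IH] x //; rewrite sorted_rcons2 => /andP[so le].
rewrite /unzip1 map_rcons all_rcons; apply/andP; split.
  by move: le; rewrite /word_le; lia.
apply: sub_all (IH y so) => z; move: le; rewrite /word_le; lia.
Qed.

Lemma mem_add_box_nth Q b i k x : b <= size Q -> x \in nth [::] (add_box Q b i) k ->
  x \in nth [::] Q k \/ x = i /\ k = b.
Proof.
rewrite /add_box nth_set_nth /= => bs; case: eqP => [->|]; last by left.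
by rewrite mem_rcons inE => /predU1P[->|]; [right|left].
Qed.

Record rsk_good (w : seq (nat * nat)) (P Q : tableau) : Prop := RskGood {
  rsk_goodP : column_strict P;
  rsk_goodQ : column_strict Q;
  rsk_good_shape : shape P = shape Q;
  rsk_good_permP : perm_eq (flatten P) (unzip2 w);
  rsk_good_permQ : perm_eq (flatten Q) (unzip1 w)
}.

Lemma size_nth_shape (T : tableau) k : size (nth [::] T k) = nth 0 (shape T) k.
Proof.
case: (ltnP k (size T)) => kT; first by rewrite (nth_map [::]).
by rewrite !nth_default ?size_map.
Qed.

(* The second part says that successive equal letters in the first row of [w] are
   placed further and further to the right, so that [Q] has strict columns. *)
Lemma rsk_word_good w : sorted word_le w ->
  rsk_good w (rsk_word w).1 (rsk_word w).2 /\
  forall w' x, w = rcons w' x -> rsk_good w' (rsk_word w').1 (rsk_word w').2 /\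
    forall k, x.1 \in nth [::] (rsk_word w').2 k -> k < bump_col (rsk_word w').1 x.2.
Proof.
elim/last_ind: w => [|w x IH] so; first by split=> // -[].
have {IH} [good IH] := IH (sorted_rcons_prefix so).
have bound k : x.1 \in nth [::] (rsk_word w).2 k -> k < bump_col (rsk_word w).1 x.2.
  case/lastP: w so IH {good} => [|w y]; first by rewrite nth_nil.
  rewrite sorted_rcons2 => /andP[so le] /(_ w y erefl)[[csP csQ sh pP pQ] IH].
  rewrite rsk_word_rcons; case: (rsk_word w) csP csQ sh pP pQ IH => P Q.
  move=> csP csQ sh pP pQ IH; rewrite rsk_step_add_box //; move: pQ IH => /= pQ IH xk.
  have bs : bump_col P y.2 <= size Q.
    by have := bump_col_le P y.2; rewrite -(size_map size Q) -/(shape Q) -sh size_map.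
  (* If [x.1] already occurs, then the last letter [y] has the same first entry because the word is
     sorted, and the box of [y] is in the rightmost column containing [x.1]. *)
  have [exy kb] : x.1 = y.1 /\ k <= bump_col P y.2.
    case: (mem_add_box_nth bs xk) => [xQ|[-> ->] //].
    have xw : x.1 \in unzip1 w.
      rewrite -(perm_mem pQ); apply/flattenP; exists (nth [::] Q k) => //.
      by rewrite mem_nth // ltnNge; apply/negP => /(nth_default [::]) e; rewrite e in xQ.
    have /allP/(_ _ xw) xy := last_row_max so.
    have e : x.1 = y.1 by move: le xy; rewrite /word_le; lia.
    by split=> //; apply/ltnW/IH; rewrite -e.
  apply: leq_ltn_trans kb (bump_col_lt _ _); first exact: column_strict_sorted.
  by move: le; rewrite /word_le exy ltnn eqxx.
split; last by move=> w' x' /rcons_inj[<- <-].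
have [csP csQ sh pP pQ] := good; rewrite rsk_word_rcons.
have maxx := last_row_max so.
case: (rsk_word w) csP csQ sh pP pQ bound => P Q csP csQ sh pP pQ bound.
rewrite rsk_step_add_box //; move: csP csQ sh pP pQ bound => /= csP csQ sh pP pQ bound.
set b := bump_col P x.2 in bound *.
have csP' := column_strict_insert x.2 csP.
have sh' : shape (col_insert P x.2) = shape (add_box Q b x.1).
  by rewrite shape_col_insert shape_add_box sh.
split=> //.
- apply: column_strict_add_box => //; first by rewrite (perm_all _ pQ).
  case: {2 3}b (erefl b) => [|b']; first by left.
  (* The shape after the insertion is a Young diagram, so column [b] was shorter than its left
     neighbour. *)
  move=> eb; right; rewrite eb /=; have := column_strict_size b' csP'.
  by rewrite !size_nth_shape shape_col_insert -/b !nth_incr_nth sh eb eqxx; case: eqP; lia.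
- rewrite (permPl (perm_col_insert _ _)) /unzip2 map_rcons perm_sym perm_rcons perm_sym.
  by rewrite perm_cons.
- rewrite (permPl (perm_add_box _ _ _)) /unzip1 map_rcons perm_sym perm_rcons perm_sym.
  by rewrite perm_cons.
Qed.

Lemma rsk_word_inj w1 w2 : sorted word_le w1 -> sorted word_le w2 ->
  rsk_word w1 = rsk_word w2 -> w1 = w2.
Proof.
elim/last_ind: w1 w2 => [|w1 x1 IH] w2 so1 so2 e.
  have [[_ _ _ _ pQ] _] := rsk_word_good so2.
  by move/perm_size: pQ; rewrite -e size_map; case: (w2).
have sz : size (rcons w1 x1) = size w2.
  have [[_ _ _ _ pQ1] _] := rsk_word_good so1.
  have [[_ _ _ _ pQ2] _] := rsk_word_good so2.
  move/perm_size: pQ1; move/perm_size: pQ2; rewrite e !size_map; congruence.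
case/lastP: w2 => [|w2 x2] in so2 e sz *; first by rewrite size_rcons in sz.
have [_ /(_ _ _ erefl)[[csP1 csQ1 sh1 pP1 pQ1] bd1]] := rsk_word_good so1.
have [_ /(_ _ _ erefl)[[csP2 csQ2 sh2 pP2 pQ2] bd2]] := rsk_word_good so2.
have m1 := last_row_max so1; have m2 := last_row_max so2.
have {}IH := IH w2 (sorted_rcons_prefix so1) (sorted_rcons_prefix so2).
move: e; rewrite !rsk_word_rcons.
case E1: (rsk_word w1) csP1 csQ1 sh1 pP1 pQ1 bd1 => [P1 Q1] /= csP1 csQ1 sh1 pP1 pQ1 bd1.
case E2: (rsk_word w2) csP2 csQ2 sh2 pP2 pQ2 bd2 => [P2 Q2] /= csP2 csQ2 sh2 pP2 pQ2 bd2.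
rewrite !rsk_step_add_box // => -[eP eQ].
set b1 := bump_col P1 x1.2 in bd1 eQ; set b2 := bump_col P2 x2.2 in bd2 eQ.
have bs P Q j : shape P = shape Q -> bump_col P j <= size Q.
  by move=> sh; rewrite -(size_map size Q) -/(shape Q) -sh size_map bump_col_le.
have e1 : x1.1 = x2.1.
  have p1 := perm_add_box Q1 b1 x1.1; have p2 := perm_add_box Q2 b2 x2.1.
  rewrite eQ in p1; apply/eqP; rewrite eqn_leq; apply/andP; split.
    have : x1.1 \in x2.1 :: flatten Q2 by rewrite -(perm_mem p2) (perm_mem p1) mem_head.
    rewrite inE (perm_mem pQ2) => /predU1P[-> //|]; exact: (allP m2).
  have : x2.1 \in x1.1 :: flatten Q1 by rewrite -(perm_mem p1) (perm_mem p2) mem_head.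
  rewrite inE (perm_mem pQ1) => /predU1P[-> //|]; exact: (allP m1).
have inb Q b i : i \in nth [::] (add_box Q b i) b.
  by rewrite /add_box nth_set_nth /= eqxx mem_rcons mem_head.
(* Column [b1] of the common recording tableau contains the last letter, and [bd2] leaves only the
   columns up to [b2] for it; the converse is symmetric. *)
have eb : b1 = b2.
  apply/eqP; rewrite eqn_leq; apply/andP; split.
    have := inb Q1 b1 x1.1; rewrite eQ e1 => /mem_add_box_nth.
    by case; [exact: bs | move/bd2/ltnW | case=> _ ->].
  have := inb Q2 b2 x2.1; rewrite -eQ -e1 => /mem_add_box_nth.
  by case; [exact: bs | move/bd1/ltnW | case=> _ ->].
have [eP' e2] := col_insert_inj csP1 csP2 eP eb.
have eQ' : Q1 = Q2.
  move: eQ; rewrite -eb -e1; apply: add_box_inj; rewrite ?column_strict_nil //.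
    exact: bs.
  by rewrite eb; exact: bs.
have -> : w1 = w2 by apply: IH; rewrite E1 E2 eP' eQ'.
congr (rcons _ _).
by case: (x1) (x2) e1 e2 => [? ?] [? ?] /= -> ->.
Qed.

Lemma rsk_word_surj P Q : column_strict P -> column_strict Q -> shape P = shape Q ->
  exists2 w, sorted word_le w & rsk_word w = (P, Q).
Proof.
have [N] := ubnP (size (flatten Q)); elim: N => // N IH in P Q *.
rewrite ltnS => szQ csP csQ sh.
case: (eqVneq (flatten Q) [::]) => [Q0|Qn0].
  exists [::] => //; have Qe : Q = [::].
    by case: Q csQ Q0 {szQ sh} => //= c Q; rewrite column_strict_cons; case: c.
  by rewrite Qe in sh *; case: P sh {csP}.
have [i iQ mi] : exists2 i, i \in flatten Q & all (leq^~ i) (flatten Q).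
  exists (\max_(x <- flatten Q) x).
    have := Qn0; elim: (flatten Q) => //= x [_ _|y s /(_ isT) IHs _].
      by rewrite big_seq1 mem_head.
    rewrite big_cons inE /maxn; case: ifP => _; last by rewrite eqxx.
    by rewrite IHs orbT.
  by apply/allP => x xQ; exact: (@leq_bigmax_seq _ (flatten Q) xpredT id).
have [Q' [b [csQ' eQ bs ib]]] := remove_box csQ mi iQ.
have szP k : size (nth [::] P k) = size (nth [::] Q' k) + (b == k).
  by rewrite size_nth_shape sh eQ shape_add_box nth_incr_nth -size_nth_shape addnC.
have corner : size (nth [::] P b.+1) < size (nth [::] P b).
  rewrite !szP eqxx; have := column_strict_size b csQ'; case: eqP; lia.
have [P' [j [csP' eP eb]]] := col_insert_surj csP corner.
(* [incr_nth] can be cancelled because no column is empty: it does not distinguish a trailing 0 from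
   an absent entry. *)
have sh' : shape P' = shape Q'.
  have : incr_nth (shape P') b = incr_nth (shape Q') b.
    by rewrite -(shape_add_box Q' b i) -eQ -sh -eP shape_col_insert eb.
  have pos T : column_strict T -> all (leq 1) (shape T).
    move/column_strict_nil; elim: T => //= c T IHT; rewrite inE negb_or => /andP[c0 /IHT ->].
    by case: c c0.
  elim: b (shape P') (shape Q') (pos _ csP') (pos _ csQ') {eQ bs ib szP corner eb}
    => [|b IHb] [|x s] [|y t] //=.
  - by move=> _ /andP[]; case: y.
  - by move=> /andP[] + _ _ []; case: x.
  - by move=> _ _ [-> ->].
  - by move=> _ /andP[+ _] []; case: y.
  - by move=> /andP[+ _] _ []; case: x.
  - by move=> /andP[_ ps] /andP[_ pt] [-> /IHb ->].
have pQ := perm_add_box Q' b i; rewrite -eQ in pQ.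
have [||||w so ew] := IH P' Q' => //.
  by move: szQ; rewrite (perm_size pQ).
exists (rcons w (i, j)); last first.
  by rewrite rsk_word_rcons ew rsk_step_add_box //= eP eb -eQ.
case/lastP: w so ew => [|w y] // so ew; rewrite sorted_rcons2 so /=.
have [[_ _ _ _ pQ'] /(_ _ _ erefl)[[csP0 csQ0 sh0 _ _] bd]] := rsk_word_good so.
rewrite ew /= in pQ'.
have yi : y.1 <= i.
  apply: (allP mi); rewrite (perm_mem pQ) inE (perm_mem pQ') /unzip1 map_rcons mem_rcons.
  by rewrite mem_head orbT.
rewrite /word_le /=; move: yi; rewrite leq_eqVlt => /predU1P[yi|->//].
(* If [y.2 < j], then [bump_col_ge] puts the box of the last letter weakly left of the box of [y],
   while [ib] puts it strictly right. *)
rewrite yi eqxx /= orbC leqNgt; apply/orP; left; apply/negP => lt.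
move: ew; rewrite rsk_word_rcons.
case E: (rsk_word w) csP0 csQ0 sh0 bd => [P0 Q0] /= csP0 csQ0 sh0 bd.
rewrite rsk_step_add_box // => -[eP' eQ'].
have := bump_col_ge (column_strict_sorted csP0) lt; rewrite eP' eb.
have : i \in nth [::] Q' (bump_col P0 y.2).
  by rewrite -eQ' /add_box nth_set_nth /= eqxx mem_rcons yi mem_head.
by move/ib; lia.
Qed.

Lemma count_two_line_array l (b : 'M[nat]_l) (a : pred (nat * nat)) :
  count a (two_line_array b) = \sum_i \sum_j b i j * a (val i, val j).
Proof.
rewrite /two_line_array count_flatten sumnE big_map big_flatten big_map big_enum /=.
apply: eq_bigr => i _; rewrite big_map (perm_big (enum 'I_l)) ?perm_rev //= big_enum.
by apply: eq_bigr => j _ /=; rewrite count_nseq mulnC.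
Qed.

Lemma pairwise_flatten_map (T I : Type) (r : rel T) (g : I -> seq T) s :
  pairwise (fun i k => allrel r (g i) (g k)) s -> all (fun i => pairwise r (g i)) s ->
  pairwise r (flatten [seq g i | i <- s]).
Proof.
elim: s => //= i s IH /andP[al pw] /andP[gi gs].
rewrite pairwise_cat IH // gi !andbT.
by elim: s al {IH pw gs} => [|k s IHs] /=; rewrite ?allrel0r // allrel_catr => /andP[-> /IHs].
Qed.

Lemma two_line_array_sorted l (b : 'M[nat]_l) : sorted word_le (two_line_array b).
Proof.
rewrite (sorted_pairwise word_le_trans) /two_line_array.
have -> : forall (T : Type) (ss : seq (seq (seq T))),
    flatten (flatten ss) = flatten (map flatten ss).
  by move=> T; elim=> //= s ss IH; rewrite flatten_cat IH.
rewrite -map_comp; apply: pairwise_flatten_map => /=.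
  have pw : pairwise (fun i k : 'I_l => i < k) (enum 'I_l).
    have := iota_ltn_sorted 0 l; rewrite -val_enum_ord (sorted_pairwise ltn_trans).
    by rewrite pairwise_map.
  apply: sub_pairwise pw => i k ik; apply/allrelP => x y.
  move=> /flattenP[t /mapP[j _ ->] /nseqP[-> _]] /flattenP[t' /mapP[j' _ ->] /nseqP[-> _]].
  by rewrite /word_le /= ik.
apply/allP => i _; apply: pairwise_flatten_map.
  have pw : pairwise (fun j k : 'I_l => k < j) (rev (enum 'I_l)).
    have := iota_ltn_sorted 0 l; rewrite -val_enum_ord -rev_sorted -map_rev.
    by rewrite (sorted_pairwise (rev_trans ltn_trans)) pairwise_map.
  apply: sub_pairwise pw => j k jk; apply/allrelP => x y /nseqP[-> _] /nseqP[-> _].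
  by rewrite /word_le /= eqxx (ltnW jk) orbT.
apply/allP => j _; elim: (b i j) => //= n ->.
by rewrite andbT all_nseq word_le_refl orbT.
Qed.

Lemma rskE l (b : 'M[nat]_l) : rsk b = rsk_word (two_line_array b).
Proof. by []. Qed.

Lemma rsk_column_strict l (b : 'M[nat]_l) :
  [/\ column_strict (rsk b).1, column_strict (rsk b).2 &
      shape (rsk b).1 = shape (rsk b).2].
Proof. by have [[]] := rsk_word_good (two_line_array_sorted b). Qed.

Lemma count_mem_rsk1 l (b : 'M[nat]_l) (k : nat) :
  count_mem k (flatten (rsk b).1) = \sum_(j < l | j == k :> nat) \sum_i b i j.
Proof.
have [[_ _ _ /permP pP _] _] := rsk_word_good (two_line_array_sorted b).
rewrite rskE pP count_map count_two_line_array exchange_big [RHS]big_mkcond /=.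
apply: eq_bigr => j _; case: eqP => _; last by rewrite big1 // => i _; rewrite muln0.
by apply: eq_bigr => i _; rewrite muln1.
Qed.

Lemma count_mem_rsk2 l (b : 'M[nat]_l) (k : nat) :
  count_mem k (flatten (rsk b).2) = \sum_(i < l | i == k :> nat) \sum_j b i j.
Proof.
have [[_ _ _ _ /permP pQ] _] := rsk_word_good (two_line_array_sorted b).
rewrite rskE pQ count_map count_two_line_array [RHS]big_mkcond /=.
apply: eq_bigr => i _; case: eqP => _; last by rewrite big1 // => j _; rewrite muln0.
by apply: eq_bigr => j _; rewrite muln1.
Qed.

Lemma rsk_inj l : injective (@rsk l).
Proof.
move=> b b'; rewrite !rskE => /rsk_word_inj e.
have {}e : two_line_array b = two_line_array b' by apply: e; exact: two_line_array_sorted.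
have cnt (c : 'M[nat]_l) i j : c i j = count_mem (val i, val j) (two_line_array c).
  rewrite count_two_line_array (bigD1 i) //= (bigD1 j) //= eqxx muln1.
  rewrite !big1 ?addn0 // => [k /negbTE ki|k /negbTE kj].
    by rewrite big1 // => k' _; rewrite xpair_eqE (inj_eq val_inj) ki muln0.
  by rewrite xpair_eqE !(inj_eq val_inj) kj andbF muln0.
by apply/matrixP => i j; rewrite !cnt e.
Qed.

Lemma rsk_surj l P Q : column_strict P -> column_strict Q -> shape P = shape Q ->
  all (gtn l) (flatten P) -> all (gtn l) (flatten Q) ->
  exists b : 'M[nat]_l, rsk b = (P, Q).
Proof.
move=> csP csQ sh aP aQ; have [w so ew] := rsk_word_surj csP csQ sh.
have [[_ _ _ pP pQ] _] := rsk_word_good so; rewrite ew /= in pP pQ.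
pose b : 'M[nat]_l := (\matrix_(i, j) count_mem (val i, val j) w)%R.
exists b; rewrite rskE -ew; congr rsk_word.
(* Both words are sorted, so it suffices to compare multiplicities; the bounds on the entries of [P]
   and [Q] exclude letters outside the range of [b]. *)
apply: (sorted_eq word_le_trans word_le_anti) => //; first exact: two_line_array_sorted.
apply/allP => -[x y] _ /=; apply/eqP; rewrite count_two_line_array.
have [/andP[xl yl]|nxy] := boolP ((x < l) && (y < l)).
  rewrite (bigD1 (Ordinal xl)) //= (bigD1 (Ordinal yl)) //= eqxx muln1.
  rewrite !big1 ?addn0 ?mxE // => [k /negbTE|k /negbTE].
    rewrite -(inj_eq val_inj) /= => ki.
    by rewrite big1 // => k' _; rewrite xpair_eqE ki muln0.
  by rewrite -(inj_eq val_inj) /= => kj; rewrite xpair_eqE kj andbF muln0.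
rewrite big1 => [|i _]; last first.
  rewrite big1 // => j _ /=; rewrite xpair_eqE.
  case: andP => [[/eqP ex /eqP ey]|_]; last by rewrite muln0.
  by case/negP: nxy; rewrite -ex -ey !ltn_ord.
apply/esym/count_memPn/negP => xyw; case/negP: nxy; apply/andP; split.
  by apply: (allP aQ); rewrite (perm_mem pQ); apply/mapP; exists (x, y).
by apply: (allP aP); rewrite (perm_mem pP); apply/mapP; exists (x, y).
Qed.

(** * Blocks of v_a *)

Section Runs.
Variable F : finFieldType.
Implicit Types f g : {poly F}.
Local Open Scope ring_scope.

(* For such [e] and [e'], the nonzero entry of the column [q] of [v_poly f] is [f`_e],
   in the row [pdeg f + q - e - e']. *)
Definition is_run f (q e e' : nat) : Prop :=
  [/\ (e <= q < e')%N, f`_e != 0, f`_e' != 0 & forall k, (e < k < e')%N -> f`_k = 0].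

Lemma monic_coef_pdeg f : f \is monic -> f`_(pdeg f) = 1.
Proof. by move/monicP. Qed.

(** The constant term provides an exponent that is at most [q], the leading term one above [q]. *)
Lemma run_exists f q : f \is monic -> f.[0] != 0 -> (q < pdeg f)%N ->
  exists e e', is_run f q e e' /\ (e' <= pdeg f)%N.
Proof.
rewrite horner_coef0 => mf f0 qd.
have ex1 : exists e, (e <= q)%N && (f`_e != 0) by exists 0%N.
have ub1 e : (e <= q)%N && (f`_e != 0) -> (e <= q)%N by case/andP.
case: (ex_maxnP ex1 ub1) => e /andP[eq fe] me.
have ex2 : exists e', (q < e')%N && (f`_e' != 0).
  by exists (pdeg f); rewrite qd monic_coef_pdeg // oner_neq0.
case: (ex_minnP ex2) => e' /andP[qe' fe'] me'.
exists e, e'; split; last by apply: me'; rewrite qd monic_coef_pdeg // oner_neq0.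
split; rewrite ?eq //= => k /andP[ek ke']; apply/eqP/negPn/negP => fk.
by case: (leqP k q) => kq; [have := me k | have := me' k]; rewrite fk kq /=; lia.
Qed.

Lemma run_compare f q q2 e e' e2 e2' :
  is_run f q e e' -> is_run f q2 e2 e2' -> (q < q2)%N ->
  (e = e2 /\ e' = e2') \/ (e' <= e2)%N.
Proof.
move=> [qr fe fe' z] [qr2 fe2 fe2' z2] lt.
have [le|gt] := leqP e' e2; [by right|left].
have ee2 : e = e2.
  apply/eqP; rewrite eqn_leq; apply/andP; split; rewrite leqNgt; apply/negP => h.
    by move: fe; rewrite z2 ?eqxx //; lia.
  by move: fe2; rewrite z ?eqxx //; lia.
split=> //; apply/eqP; rewrite eqn_leq; apply/andP; split; rewrite leqNgt; apply/negP => h.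
  by move: fe2'; rewrite z ?eqxx //; lia.
by move: fe'; rewrite z2 ?eqxx //; lia.
Qed.

(** The rows of the run [e, e') fill the interval from d - e' to d - e - 1, so a later run lies
    above an earlier one; inside a run, p - q is constant. *)
Lemma run_compare_pos f q q2 e e' e2 e2' d p p2 :
  is_run f q e e' -> is_run f q2 e2 e2' -> (q < q2)%N ->
  (p + e + e' = d + q)%N -> (p2 + e2 + e2' = d + q2)%N ->
  (p2 < p)%N \/ (p2 + q = p + q2)%N /\ e = e2.
Proof.
move=> r1 r2 lt h1 h2; case: (run_compare r1 r2 lt) => [[? ?]|le].
  by right; split=> //; lia.
by left; case: r1 => + _ _ _; case: r2 => + _ _ _; lia.
Qed.

(** The hypothesis is what a matrix shows of a run: its sum e + e' and its value. If a run of [f],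
    but none of [g], started at [k], then k - 1 and [k] would lie in one run of [g], and the sums of
    [f] at both would agree; but the sum strictly increases from one run to the next. *)
Lemma coef_eq_of_runs f g k : f \is monic -> g \is monic -> f.[0] != 0 -> g.[0] != 0 ->
  pdeg f = pdeg g ->
  (forall q e e' e2 e2', (q < pdeg f)%N -> is_run f q e e' -> is_run g q e2 e2' ->
     (e + e' = e2 + e2')%N /\ f`_e = g`_e2) ->
  (k < pdeg f)%N -> f`_k != 0 -> g`_k = f`_k.
Proof.
move=> mf mg f0 g0 dfg H kd fk.
have [e [e' [r _]]] := run_exists mf f0 kd.
have kd' : (k < pdeg g)%N by rewrite -dfg.
have [e2 [e2' [r2 _]]] := run_exists mg g0 kd'.
have [s1 s2] := H _ _ _ _ _ kd r r2.
have ek : e = k.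
  case: r => qe _ _ z; apply/eqP; rewrite eqn_leq; apply/andP; split; first lia.
  by rewrite leqNgt; apply/negP => h; move: fk; rewrite z ?eqxx //; lia.
rewrite ek in s1 s2 r.
have [e2k|ne2k] := eqVneq e2 k; first by rewrite s2 e2k.
have k1d : (k.-1 < pdeg f)%N by lia.
have [e1 [e1' [r1 _]]] := run_exists mf f0 k1d.
have r2' : is_run g k.-1 e2 e2' by case: r2 => *; split=> //; lia.
have [t1 _] := H _ _ _ _ _ k1d r1 r2'.
have kk : (k.-1 < k)%N by case: r2; lia.
case: (run_compare r1 r kk) => [[]|]; first by case: r1; lia.
case: r1 => qe1 _ fe1' z1 le.
have : e1' = k by lia.
by case: r; lia.
Qed.

Lemma poly_eq_of_runs f g : f \is monic -> g \is monic -> f.[0] != 0 -> g.[0] != 0 ->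
  pdeg f = pdeg g ->
  (forall q e e' e2 e2', (q < pdeg f)%N -> is_run f q e e' -> is_run g q e2 e2' ->
     (e + e' = e2 + e2')%N /\ f`_e = g`_e2) -> f = g.
Proof.
move=> mf mg f0 g0 dfg H; apply/polyP => k.
have [kd|dk] := ltnP k (pdeg f).
  have [fk|fk] := eqVneq f`_k 0; last by rewrite (coef_eq_of_runs mf mg).
  have [gk|gk] := eqVneq g`_k 0; first by rewrite fk gk.
  rewrite (coef_eq_of_runs mg mf) -?dfg // => q e e' e2 e2' qd r1 r2.
  by have [-> ->] := H _ _ _ _ _ qd r2 r1.
move: dk; rewrite leq_eqVlt => /predU1P[<-|dk].
  by rewrite {2}dfg !monic_coef_pdeg.
rewrite !nth_default //; first by move: dk; rewrite dfg /pdeg; case: (size g).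
by move: dk; rewrite /pdeg; case: (size f).
Qed.

Lemma count_ltn_iota v d : (v <= d)%N -> count (gtn v) (iota 0 d) = v.
Proof.
move=> vd; rewrite -(subnKC vd) iotaD count_cat add0n.
rewrite (_ : count _ (iota v _) = 0%N) ?addn0.
  rewrite -[RHS](size_iota 0); apply/eqP; rewrite -all_count.
  by apply/allP => k; rewrite mem_iota.
by apply/eqP; rewrite -leqn0 leqNgt -has_count; apply/hasPn => k; rewrite mem_iota /=; lia.
Qed.

(** Runs start at column 0 and at the descents of [p], and the coefficients [x q] are put at these
    exponents. The point is that each run then occupies exactly the rows imposed by its two
    exponents. *)
Lemma run_poly_exists d (p : nat -> nat) (x : nat -> F) :
  (forall q, (q < d)%N -> (p q < d)%N /\ x q != 0) ->
  (forall q q', (q < d)%N -> (q' < d)%N -> p q = p q' -> q = q') ->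
  (forall q, (q.+1 < d)%N -> (p q.+1 < p q)%N \/ p q.+1 = (p q).+1 /\ x q.+1 = x q) ->
  exists f, [/\ f \is monic, f.[0] != 0, pdeg f = d &
    forall q e e', (q < d)%N -> is_run f q e e' ->
      (p q + e + e' = d + q)%N /\ f`_e = x q].
Proof.
move=> pd pinj step.
pose start q := (q == 0)%N || (p q < p q.-1)%N.
pose f := \poly_(q < d.+1) (if q == d then 1 else if start q then x q else 0).
have fd : f`_d = 1 by rewrite coef_poly ltnSn eqxx.
have fE q : (q < d)%N -> f`_q = if start q then x q else 0.
  by move=> qd; rewrite coef_poly ltnS (ltnW qd) (_ : q == d = false) //; lia.
have szf : size f = d.+1.
  by apply: size_poly_eq; rewrite eqxx oner_neq0.
have mf : f \is monic by rewrite monicE /lead_coef szf fd.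
have f0 : f.[0] != 0.
  rewrite horner_coef0; case: (posnP d) => [d0|d0]; first by rewrite -[X in f`_X]d0 fd oner_neq0.
  by rewrite fE //= ; have [] := pd _ d0.
(* A descent from the run of [q] lands below [p q], since the values of the run are taken;
   afterwards [p] rises only by steps of 1 and cannot take the value [p q] again. *)
have cmp m q : (q + m < d)%N ->
    ((forall k, (q < k <= q + m)%N -> ~~ start k) /\ p (q + m)%N = (p q + m)%N /\ x (q + m)%N = x q)
    \/ (exists2 k, (q < k <= q + m)%N & start k) /\ (p (q + m)%N < p q)%N.
  elim/ltn_ind: m => m IH qm; case: m IH qm => [|m] IH qm.
    by left; rewrite !addn0; split=> // k; lia.
  have qm' : (q + m < d)%N by lia.
  rewrite addnS in qm *; have := IH m (ltnSn m) qm'; have := step _ qm.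
  have sE : start (q + m).+1 = (p (q + m).+1 < p (q + m))%N by [].
  case=> [ltp|[ep ex]]; case=> [[ns [ep' ex']]|[[k kq sk] ltp']].
  - right; split; first by exists (q + m).+1; rewrite ?sE //; lia.
    rewrite ltnNge; apply/negP => ge.
    pose t := (p (q + m).+1 - p q)%N; have tm : (t < m.+1)%N by lia.
    have qt : (q + t < d)%N by lia.
    case: (IH t tm qt) => [[_ [e _]]|[[k kq sk] _]].
      by have := pinj _ _ qt qm; lia.
    by have := ns k; rewrite sk /=; lia.
  - by right; split; [exists k => //; lia|lia].
  - left; split; last by rewrite ep ep' ex ex' addnS.
    move=> k kq; have [->|nk] := eqVneq k (q + m).+1; first by rewrite sE ep; lia.
    by apply: ns; lia.
  - right; split; first by exists k => //; lia.
    have : (p (q + m).+1 != p q)%N by apply/eqP => /pinj; lia.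
    by rewrite ep; lia.
exists f; split; rewrite // ?/pdeg ?szf //.
move=> q e e' qd [qr fe fe' z].
have ed : (e < d)%N by lia.
have se : start e by move: fe; rewrite fE //; case: ifP => //; rewrite eqxx.
have e'd : (e' <= d)%N.
  by rewrite leqNgt; apply/negP => h; move: fe'; rewrite nth_default ?eqxx // szf.
have nostart k : (e < k < e')%N -> ~~ start k.
  move=> ke; have kd : (k < d)%N by lia.
  have := z k ke; rewrite fE //; case: ifP => // _ xk.
  by have [_] := pd _ kd; rewrite xk eqxx.
have cmp' k k' : (k <= k' < d)%N ->
    ((forall i, (k < i <= k')%N -> ~~ start i) /\ p k' = (p k + (k' - k))%N /\ x k' = x k)
    \/ (exists2 i, (k < i <= k')%N & start i) /\ (p k' < p k)%N.
  by move=> kk; have := @cmp (k' - k)%N k; rewrite subnKC; [apply|]; lia.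
(* As [p] permutes the integers below [d], [p e] is the number of columns with a smaller value; by
   [cmp'] these are the columns from [e'] on. *)
have pe : p e = (d - e')%N.
  have pperm : perm_eq (map p (iota 0 d)) (iota 0 d).
    have u : uniq (map p (iota 0 d)).
      rewrite map_inj_in_uniq ?iota_uniq // => k k'; rewrite !mem_iota !add0n => kd kd'.
      exact: pinj.
    have [|| _ eqi] := uniq_min_size u (s2 := iota 0 d).
    - by move=> y /mapP[k]; rewrite !mem_iota !add0n => kd ->; have [] := pd _ kd.
    - by rewrite size_map leqnn.
    - by apply: uniq_perm; rewrite ?iota_uniq.
  have ped : (p e <= d)%N by have [] := pd _ ed; lia.
  rewrite -(count_ltn_iota ped) -(permP pperm) count_map.
  rewrite (@eq_in_count _ _ (predC (gtn e'))).
    have := count_predC (gtn e') (iota 0 d); rewrite (count_ltn_iota e'd) size_iota.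
    by set m := count _ _ => h; rewrite -{1}h addKn.
  move=> k; rewrite mem_iota add0n => /andP[_ kd] /=.
  rewrite -leqNgt; have [le|gt] := leqP e' k.
    have kk : (e <= k < d)%N by lia.
    case: (cmp' _ _ kk) => [[ns _]|[_ ->]//].
    have e'd' : (e' < d)%N by lia.
    case/negP: (ns e' ltac:(lia)); move: fe'; rewrite fE //; case: ifP => //.
    by rewrite eqxx.
  have [le|lt] := leqP e k.
    have kk : (e <= k < d)%N by lia.
    case: (cmp' _ _ kk) => [[_ [-> _]]|[[i ik si] _]]; first by lia.
    by case/negP: (nostart i ltac:(lia)).
  have kk : (k <= e < d)%N by lia.
  case: (cmp' _ _ kk) => [[ns _]|[_ h]]; last by lia.
  by case/negP: (ns e ltac:(lia)).
have eq : (e <= q < d)%N by lia.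
case: (cmp' _ _ eq) => [[_ [ep ex]]|[[i ik si] _]].
  by rewrite fE // se ex; split=> //; lia.
by case/negP: (nostart i ltac:(lia)).
Qed.

End Runs.

(** * Entries of the matrices v_(f) *)

Section BlockEntries.
Variable F : finFieldType.
Local Open Scope ring_scope.

(** With S the sum of the sizes in [s1], the antidiagonal of the block is (r - S) + (c - S) = k - 1,
    written here without subtraction. *)
Lemma dsum_antidiagE (s1 s2 : seq (F * nat)) x k
    (r c : 'I_(sumn (unzip2 (s1 ++ (x, k) :: s2)))) :
  (sumn (unzip2 s1) <= c < sumn (unzip2 s1) + k)%N ->
  dsum_antidiag (s1 ++ (x, k) :: s2) r c =
    x *+ (r + c + 1 == sumn (unzip2 s1) + sumn (unzip2 s1) + k)%N.
Proof.
elim: s1 r c => [|[y h] s1 IH] /= r c.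
  rewrite add0n => ck; rewrite /block_mx mxE.
  case: splitP => r' er; rewrite mxE; case: splitP => c' ec; rewrite ?mxE.
  - rewrite mulr_natr; congr (_ *+ _); move: (ltn_ord r') (ltn_ord c').
    by rewrite er ec => *; congr nat_of_bool; apply/eqP/eqP; lia.
  - by move: ck; rewrite ec; lia.
  - by rewrite (_ : _ == _ = false) //; move: (ltn_ord c'); rewrite er ec; lia.
  - by move: ck; rewrite ec; lia.
move=> ck; rewrite /block_mx mxE.
case: splitP => r' er; rewrite mxE; case: splitP => c' ec; rewrite ?mxE.
- by move: (ltn_ord c'); rewrite -ec; lia.
- rewrite (_ : _ == _ = false) //; move: (ltn_ord r'); rewrite er; lia.
- by move: (ltn_ord c'); rewrite -ec; lia.
rewrite IH; last by move: ck; rewrite ec; lia.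
by rewrite er ec; congr (_ *+ nat_of_bool _); apply/eqP/eqP; lia.
Qed.

(** [poly_gaps] with a free end point [m], so that the list can be cut at an exponent, which becomes
    the end point of the first piece. *)
Definition gaps (g : nat -> F) (s : seq nat) (m : nat) : seq (F * nat) :=
  [seq (g x.1, (x.2 - x.1)%N) | x <- zip s (behead (rcons s m))].

Lemma gaps_cons g a s m :
  gaps g (a :: s) m = (g a, (head m s - a)%N) :: gaps g s m.
Proof. by case: s. Qed.

Lemma gaps_cat g s e t m :
  gaps g (s ++ e :: t) m = gaps g s e ++ gaps g (e :: t) m.
Proof.
elim: s => [|a s IH] //; rewrite cat_cons [LHS]gaps_cons IH (gaps_cons g a s e) cat_cons.
by have -> : head m (s ++ e :: t) = head e s by case: (s).
Qed.

Lemma sumn_gaps g a s m : path leq a (rcons s m) ->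
  (a + sumn (unzip2 (gaps g (a :: s) m)) = m)%N.
Proof.
elim: s a => [|b s IH] a; first by rewrite /= andbT addn0 => /subnKC.
rewrite [path _ _ _]/= => /andP[ab /IH]; rewrite [gaps g (a :: _) m]gaps_cons.
set u := gaps g (b :: s) m => h.
by rewrite -[LHS]/(a + ((b - a) + sumn (unzip2 u)))%N addnA subnKC.
Qed.

Lemma sumn_gaps_filter (g : nat -> F) (P : pred nat) m : (0 < m)%N -> P 0 ->
  sumn (unzip2 (gaps g (filter P (iota 0 m)) m)) = m.
Proof.
case: m => // m _ P0; rewrite /= P0 -[LHS]add0n; apply: sumn_gaps.
rewrite rcons_path; apply/andP; split.
  have : sorted leq (0 :: filter P (iota 1 m)).
    have -> : 0%N :: filter P (iota 1 m) = filter P (iota 0 m.+1) by rewrite /= P0.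
    by apply: (sorted_filter leq_trans); exact: iota_sorted.
  by [].
have : all (gtn m.+1) (0%N :: filter P (iota 1 m)).
  by apply/allP => k; rewrite inE mem_filter mem_iota /=; case: eqP; lia.
by move/allP/(_ _ (mem_last _ _)) => /= /ltnW.
Qed.

Lemma poly_gaps_run (f : {poly F}) q e e' : f.[0] != 0 -> (q < pdeg f)%N ->
  is_run f q e e' -> (e' <= pdeg f)%N ->
  exists s1 s2, poly_gaps f = s1 ++ (f`_e, (e' - e)%N) :: s2 /\ sumn (unzip2 s1) = e.
Proof.
rewrite horner_coef0 => f0 qd [qr fe fe' z] e'd.
set m := pdeg f in qd e'd *.
pose P k := f`_k != 0.
have -> : poly_gaps f = gaps (fun k => f`_k) (filter P (iota 0 m)) m by [].
have -> : iota 0 m = iota 0 e ++ e :: iota e.+1 (e' - e.+1) ++ iota e' (m - e').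
  have {1}-> : m = (e + (1 + ((e' - e.+1) + (m - e'))))%N by lia.
  rewrite !iotaD /= add0n addn1; congr (_ ++ _ :: _ ++ iota _ _); lia.
rewrite !filter_cat /= {2}/P fe gaps_cat gaps_cons filter_cat.
have -> : filter P (iota e.+1 (e' - e.+1)) = [::].
  apply/eqP; rewrite -(negbK (_ == _)) -has_filter; apply/hasPn => k.
  by rewrite mem_iota => ke; rewrite /P z ?eqxx //; lia.
(* The default [m] covers the last run, where [e'] equals [m] and no exponent remains. *)
have -> : head m ([::] ++ filter P (iota e' (m - e'))) = e'.
  case E : (m - e')%N => [|k] /=; first by lia.
  by rewrite {1}/P fe'.
set s2 := gaps _ ([::] ++ _) m; exists (gaps (fun k => f`_k) (filter P (iota 0 e)) e), s2.
split=> //; case: (posnP e) => [->|e0] //; exact: sumn_gaps_filter.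
Qed.

Lemma conform_mxE m k (A : 'M[F]_k) (i j : 'I_m) (i' j' : 'I_k) : k = m ->
  i = i' :> nat -> j = j' :> nat -> conform_mx (0 : 'M[F]_m) A i j = A i' j'.
Proof.
move=> ekm; case: m / ekm i j => i j ei ej; rewrite conform_mx_id.
by congr (A _ _); apply: val_inj.
Qed.

Lemma v_polyE (f : {poly F}) (p q : 'I_(pdeg f)) e e' : f.[0] != 0 ->
  is_run f q e e' -> (e' <= pdeg f)%N ->
  v_poly f p q = f`_e *+ (p + e + e' == pdeg f + q)%N.
Proof.
move=> f0 r e'd; rewrite /v_poly mxE (bigD1 (rev_ord p)) //=.
have pd := ltn_ord p; have qd := ltn_ord q.
rewrite [X in _ + X]big1 ?addr0 => [|k /eqP kp]; last first.
  rewrite mxE (_ : _ == _ = false) ?mul0r //; apply/negP => /eqP h.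
  by case: kp; apply: val_inj => /=; lia.
rewrite mxE (_ : _ == _ = true) ?mul1r; last by apply/eqP => /=; lia.
have [s1 [s2 [eg es]]] := poly_gaps_run f0 qd r e'd.
have ek : sumn (unzip2 (poly_gaps f)) = pdeg f.
  by rewrite /poly_gaps; apply: sumn_gaps_filter; [lia|rewrite -horner_coef0].
have rk : (rev_ord p < sumn (unzip2 (poly_gaps f)))%N by rewrite ek.
have ck : (q < sumn (unzip2 (poly_gaps f)))%N by rewrite ek.
rewrite (@conform_mxE _ _ _ _ _ (Ordinal rk) (Ordinal ck)) //.
case: r => qr _ _ _.
move: rk ck {ek}; rewrite eg => rk ck; rewrite dsum_antidiagE /= es; last by lia.
by congr (_ *+ nat_of_bool _); apply/eqP/eqP; lia.
Qed.

End BlockEntries.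

(** * Offsets of the parts of mu and of the blocks *)

Section PartialSums.
Variable l : nat.
Implicit Types (h : 'I_l -> nat) (i j : 'I_l).

Definition psum h (m : nat) := \sum_(k < l | k < m) h k.

Lemma psumS h j : psum h j.+1 = psum h j + h j.
Proof.
rewrite /psum (bigD1 j) ?ltnSn //= addnC; congr (_ + _); apply: eq_bigl => k.
by rewrite -(inj_eq val_inj) /=; lia.
Qed.

Lemma psum_mono h m m' : m <= m' -> psum h m <= psum h m'.
Proof.
move=> le; rewrite /psum [X in _ <= X](bigID (fun k : 'I_l => k < m)) /=.
rewrite -[X in X <= _]addn0 leq_add // leq_eqVlt; apply/orP; left; apply/eqP.
by apply: eq_bigl => k; lia.
Qed.

Lemma psum_lt h j j' : j < j' -> psum h j + h j <= psum h j'.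
Proof. by rewrite -psumS; exact: psum_mono. Qed.

Lemma psum0 h : psum h 0 = 0.
Proof. by rewrite /psum big_pred0. Qed.

Lemma psum_all h m : l <= m -> psum h m = \sum_k h k.
Proof. by move=> lm; apply: eq_bigl => k; apply: leq_trans lm. Qed.

Lemma psum_exists h c : c < \sum_k h k ->
  exists j, psum h j <= c < psum h j + h j.
Proof.
move=> ch; have ex : exists m, c < psum h m by exists l; rewrite psum_all.
case: (ex_minnP ex) => -[|m] cm mm; first by rewrite psum0 in cm.
have ml : m < l.
  rewrite ltnNge; apply/negP => lm; have := mm m.
  by rewrite psum_all // ch => /(_ isT); rewrite ltnn.
exists (Ordinal ml); rewrite -psumS cm andbT leqNgt.
by apply/negP => /mm; rewrite ltnn.
Qed.

(** Inside a part of mu the blocks come in decreasing order of index, so their offsets are sums over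
    larger indices; reversing the indices turns them into partial sums. *)
Lemma psum_rev h i :
  \sum_(k < l | i < k) h k = psum (fun k => h (rev_ord k)) (rev_ord i).
Proof.
rewrite /psum (reindex_inj rev_ord_inj) /=; apply: eq_bigl => k.
by have := ltn_ord i; have := ltn_ord k; lia.
Qed.

Lemma rsum_lt h i i' : i' < i ->
  \sum_(k < l | i < k) h k + h i <= \sum_(k < l | i' < k) h k.
Proof.
move=> lt; rewrite !psum_rev -{2}(rev_ordK i).
apply: (@psum_lt (fun k => h (rev_ord k))) => /=.
by have := ltn_ord i; lia.
Qed.

Lemma rsum_exists h c : c < \sum_k h k ->
  exists i, \sum_(k < l | i < k) h k <= c < \sum_(k < l | i < k) h k + h i.
Proof.
rewrite (reindex_inj rev_ord_inj) /= => /psum_exists[j cj].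
by exists (rev_ord j); rewrite psum_rev rev_ordK.
Qed.

End PartialSums.

Section Blocks.
Variables (l : nat) (mu : l.-tuple nat).
Implicit Types (i j : 'I_l) (d : 'I_l -> 'I_l -> nat).

Definition in_block j (c : nat) : bool :=
  psum (tnth mu) j <= c < psum (tnth mu) j + tnth mu j.

Lemma in_block_le j j' c c' : in_block j c -> in_block j' c' -> c <= c' -> j <= j'.
Proof.
move=> /andP[cj _] /andP[_ cj'] le; rewrite leqNgt; apply/negP => /(psum_lt (tnth mu)).
lia.
Qed.

Lemma in_block_inj j j' c : in_block j c -> in_block j' c -> j = j'.
Proof.
by move=> h h'; apply/val_inj/eqP; rewrite eqn_leq !(in_block_le _ _ (leqnn c)).
Qed.

Lemma partial_sumsP m :
  reflect (exists j, m = psum (tnth mu) j.+1) (m \in partial_sums mu).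
Proof.
have E k : k <= l -> foldl addn 0 (take k mu) = psum (tnth mu) k.
  elim: k => [|k IH] kl; first by rewrite take0 psum0.
  rewrite (take_nth 0) ?size_tuple // foldl_rcons IH; last by lia.
  by rewrite -[k]/(val (Ordinal kl)) psumS (tnth_nth 0).
apply: (iffP (nthP 0)) => [[k]|[j ->]]; rewrite /partial_sums.
  rewrite size_scanl size_tuple => kl <-; exists (Ordinal kl).
  by rewrite nth_scanl ?size_tuple // E.
exists j; first by rewrite size_scanl size_tuple.
by rewrite nth_scanl ?size_tuple // E.
Qed.

Definition internal (c : nat) : bool := c.+1 \notin partial_sums mu.

Lemma internal_block j c : in_block j c -> internal c = in_block j c.+1.
Proof.
move=> cj; apply/negP/idP => [np|cj' /partial_sumsP[j']].
  case/andP: cj => c1 c2; apply/andP; split; first by lia.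
  rewrite ltn_neqAle c2 andbT; apply/eqP => e; apply: np.
  by apply/partial_sumsP; exists j; rewrite psumS.
rewrite psumS; case/andP: cj => c1 c2; case/andP: cj' => c3 c4 e.
have [lt|lt|/val_inj ee] := ltngtP j j'; last by move: e c4; rewrite ee; lia.
  by have := psum_lt (tnth mu) lt; lia.
by have := psum_lt (tnth mu) lt; lia.
Qed.

(* First column of the block [(i, j)] of [v_a], where [d] gives the sizes of the
   blocks; the first row is obtained by exchanging the indices of [d]. *)
Definition coff d i j : nat := psum (tnth mu) j + \sum_(k < l | i < k) d k j.

Lemma coff_in_block d i j q : (forall j, \sum_i d i j = tnth mu j) ->
  q < d i j -> in_block j (coff d i j + q).
Proof.
move=> cs qd; rewrite /in_block /coff -cs -addnA leq_addr /= ltn_add2l.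
rewrite [X in _ < X](bigID (fun k : 'I_l => i < k)) /= ltn_add2l (bigD1 i) ?ltnn //=.
exact: ltn_addr.
Qed.

Lemma coff_lt d i j q i' j' q' : (forall j, \sum_i d i j = tnth mu j) ->
  q < d i j -> q' < d i' j' -> coff d i j + q <= coff d i' j' + q' ->
  j < j' \/ j = j' /\ (i' < i \/ i = i' /\ q <= q').
Proof.
move=> cs qd qd' le.
have := in_block_le (coff_in_block cs qd) (coff_in_block cs qd') le.
rewrite leq_eqVlt => /predU1P[/val_inj ej|]; last by left.
right; split=> //; rewrite -{j'}ej in qd' le *.
have [lt|lt|/val_inj ei] := ltngtP i i'; last 2 first.
- by left.
- by right; split=> //; rewrite -ei in le; lia.
by have := rsum_lt (fun k => d k j) lt; rewrite /coff in le; lia.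
Qed.

Lemma coff_inj d i j q i' j' q' : (forall j, \sum_i d i j = tnth mu j) ->
  q < d i j -> q' < d i' j' -> coff d i j + q = coff d i' j' + q' ->
  [/\ i = i', j = j' & q = q'].
Proof.
move=> cs qd qd' e; have := coff_lt cs qd qd'; have := coff_lt cs qd' qd.
rewrite e leqnn => /(_ isT) h1 /(_ isT) h2.
have ej : j = j' by case: h1 h2 => [h|[-> _]//] [h'|[-> _]//]; lia.
have ei : i = i'.
  by case: h1 h2 => [h|[_ [h|[-> _]//]]] [h'|[_ [h'|[-> _]//]]]; try lia; move: h h'; rewrite ej; lia.
by split=> //; move: e; rewrite ei ej; lia.
Qed.

End Blocks.

Lemma card_ord_interval n a b : b <= n -> #|[set c : 'I_n | a <= c < b]| = b - a.
Proof.
move=> bn; rewrite cardsE cardE /enum_mem size_filter -enumT.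
rewrite (eq_count (a2 := preim val (fun c => a <= c < b))) //.
rewrite -count_map val_enum_ord.
have [ba|ab] := leqP b a.
  rewrite (_ : b - a = 0); last by lia.
  by apply/eqP; rewrite -leqn0 leqNgt -has_count; apply/hasPn => k _; lia.
have -> : n = a + ((b - a) + (n - b)) by lia.
rewrite !iotaD !count_cat add0n.
rewrite [X in X + _](_ : _ = 0); last first.
  by apply/eqP; rewrite -leqn0 leqNgt -has_count; apply/hasPn => k; rewrite mem_iota; lia.
rewrite [X in _ + (_ + X)](_ : _ = 0); last first.
  by apply/eqP; rewrite -leqn0 leqNgt -has_count; apply/hasPn => k; rewrite mem_iota; lia.
rewrite addn0 add0n -[RHS](size_iota a); apply/eqP; rewrite -all_count.
by apply/allP => k; rewrite mem_iota; lia.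
Qed.

Section BlockDecomposition.
Variables (n l : nat) (mu : l.-tuple nat).
Hypothesis sum_mu : sumn mu = n.
Implicit Types (i j : 'I_l) (d : 'I_l -> 'I_l -> nat).

Lemma sum_tnth : \sum_j tnth mu j = n.
Proof. by rewrite -sum_mu sumnE big_tuple. Qed.

Lemma in_block_exists c : c < n -> exists j, in_block mu j c.
Proof. by rewrite -sum_tnth; exact: psum_exists. Qed.

Lemma in_block_ltn j c : in_block mu j c -> c < n.
Proof.
move=> /andP[_]; rewrite -psumS => /leq_trans; apply.
by rewrite -sum_tnth -(psum_all (tnth mu) (leqnn l)) psum_mono.
Qed.

Lemma coff_exists d c : (forall j, \sum_i d i j = tnth mu j) -> c < n ->
  exists i j q, q < d i j /\ c = coff mu d i j + q.
Proof.
move=> cs /in_block_exists[j /andP[c1 c2]].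
have cj : c - psum (tnth mu) j < \sum_i d i j by rewrite cs; lia.
have [i /andP[i1 i2]] := rsum_exists cj.
exists i, j, (c - psum (tnth mu) j - \sum_(k < l | i < k) d k j).
by rewrite /coff; split; lia.
Qed.

Lemma psum_le_n j : psum (tnth mu) j + tnth mu j <= n.
Proof. by rewrite -psumS -sum_tnth -(psum_all (tnth mu) (leqnn l)) psum_mono. Qed.

Lemma card_in_block j : #|[set c : 'I_n | in_block mu j c]| = tnth mu j.
Proof. by rewrite card_ord_interval ?psum_le_n // addKn. Qed.

(* Within each block of columns, [g] weakly decreases, so that the columns with a
   given value of [g] are consecutive. *)
Lemma coff_of_monotone (b g : 'I_n -> 'I_l) (d : 'I_l -> 'I_l -> nat) (c : 'I_n) :
  (forall c : 'I_n, in_block mu (b c) c) ->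
  (forall c c' : 'I_n, c <= c' -> b c = b c' -> g c' <= g c) ->
  (forall i j, d i j = #|[set c | (b c == j) && (g c == i)]|) ->
  coff mu d (g c) (b c) <= c < coff mu d (g c) (b c) + d (g c) (b c).
Proof.
move=> bP mono dE; set i := g c; set j := b c.
have bE c' : (b c' == j) = in_block mu j c'.
  apply/eqP/idP => [<-|h]; first exact: bP.
  exact: in_block_inj (bP c') h.
have sumE (P : pred 'I_l) :
    \sum_(k | P k) d k j = #|[set c' | (b c' == j) && P (g c')]|.
  rewrite (eq_bigr _ (fun k _ => dE k j)) -sum1dep_card (partition_big g P) /=.
    apply: eq_bigr => k Pk; rewrite -sum1dep_card; apply: eq_bigl => c'.
    by case: (b c' == j) => //=; case: (eqVneq (g c') k) => [->|_]; rewrite ?Pk ?andbF.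
  by move=> c' /andP[].
have /andP[c1 c2] := bP c; rewrite -/j in c1 c2.
have cn := ltn_ord c.
(* The columns of block [j] with a value above [i] all precede [c], and all its columns up to [c]
   have a value at least [i]; counting them gives the two inequalities. *)
apply/andP; split.
  rewrite /coff sumE.
  have : #|[set c' | (b c' == j) && (i < g c')]| <=
         #|[set c' : 'I_n | psum (tnth mu) j <= c' < c]|.
    apply/subset_leq_card/fintype.subsetP => c'; rewrite !inE => /andP[bc' lt].
    have /andP[-> _] : in_block mu j c' by rewrite -bE.
    rewrite /= ltnNge; apply/negP => le; move: lt; rewrite ltnNge mono //.
    by apply/eqP; rewrite eq_sym.
  by rewrite card_ord_interval; lia.
have eS : \sum_(k < l | i < k) d k j + d i j = \sum_(k < l | i <= k) d k j.
  rewrite [RHS](bigD1 i) //= addnC; congr (_ + _); apply: eq_bigl => k.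
  by rewrite -(inj_eq val_inj) /=; lia.
rewrite /coff -addnA eS sumE.
have : #|[set c' : 'I_n | psum (tnth mu) j <= c' < c.+1]| <=
       #|[set c' | (b c' == j) && (i <= g c')]|.
  apply/subset_leq_card/fintype.subsetP => c'; rewrite !inE bE => /andP[h1 h2].
  have bj : in_block mu j c' by rewrite /in_block; lia.
  by rewrite bj /=; apply: mono; [rewrite -ltnS|apply/eqP; rewrite bE].
by rewrite card_ord_interval; lia.
Qed.

End BlockDecomposition.

(** * Monomial matrices in N_mu *)

Section Monomial.
Variables (F : finFieldType) (n : nat).
Implicit Types (v u : 'M[F]_n) (w : 'I_n -> 'I_n) (x : 'I_n -> F).
Local Open Scope ring_scope.

(** Thus [v] maps the basis vector e_c to [x c] times e_(w c), and conjugation by [v] moves the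
    indices of root elements by [w]. *)
Definition has_monomial_form v w x : Prop :=
  [/\ injective w, forall c, x c != 0 & forall r c, v r c = if r == w c then x c else 0].

Lemma monomial_formP v : monomial_mx v <-> exists w x, has_monomial_form v w x.
Proof.
split=> [[vr vc]|[w [x [winj x0 vE]]]].
  have [w wP] := fin_all_exists vc.
  have wE c r : v r c != 0 -> r = w c by move=> h; apply/esym/(proj2 (wP c)).
  have w0 c : v (w c) c != 0 by have [] := wP c.
  exists w, (fun c => v (w c) c); split=> [c c' e|//|r c].
    have [k [_ uk]] := vr (w c).
    by rewrite -(uk c (w0 c)) (uk c') // e.
  case: eqP => [->|/eqP ne] //.
  by apply/eqP/negPn/negP => /wE/eqP; rewrite (negbTE ne).
have vE' r c : (v r c != 0) = (r == w c).
  by rewrite vE; case: ifP => _; rewrite ?x0 ?eqxx.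
split=> [r|c].
  exists (invF winj r); split; first by rewrite vE' f_invF.
  by move=> c; rewrite vE' => /eqP->; rewrite invF_f.
by exists (w c); split=> [|r]; rewrite vE' ?eqxx // => /eqP.
Qed.

Lemma monomial_unit v w x : has_monomial_form v w x -> v \in unitmx.
Proof.
case=> winj x0 vE.
suff h : (\matrix_(c, r) (if r == w c then (x c)^-1 else 0)) *m v = 1%:M by have [] := mulmx1_unit h.
apply/matrixP => c c'; rewrite !mxE (bigD1 (w c)) //= big1 => [|r /negbTE ne].
  rewrite mxE eqxx vE (inj_eq winj) addr0; case: eqP => [<-|_]; last exact: mulr0.
  by rewrite mulVf.
by rewrite mxE ne mul0r.
Qed.

(** This is the entry (w c, c') of the identity (v u v^-1) v = v u. *)
Lemma monomial_conj v w x u c c' : has_monomial_form v w x ->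
  (v *m u *m invmx v) (w c) (w c') * x c' = x c * u c c'.
Proof.
move=> vf; have vu := monomial_unit vf; case: vf => winj x0 vE.
have /matrixP/(_ (w c) c') := mulmxKV vu (v *m u).
rewrite mxE (bigD1 (w c')) //= vE eqxx big1 ?addr0 => [->|r /negbTE ne]; last first.
  by rewrite vE ne mulr0.
rewrite mxE (bigD1 c) //= vE eqxx big1 ?addr0 // => k /negbTE ne.
by rewrite vE (inj_eq winj) eq_sym ne mul0r.
Qed.

Lemma root_eltE (i j r c : 'I_n) (t : F) :
  root_elt i j t r c = (r == c)%:R + if (r == i) && (c == j) then t else 0.
Proof. by rewrite !mxE; case: ifP => _; rewrite ?mulr1 ?mulr0. Qed.

Lemma monomial_conj_root v w x (c c' : 'I_n) t : has_monomial_form v w x ->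
  v *m root_elt c c' t *m invmx v = root_elt (w c) (w c') (x c * t / x c').
Proof.
move=> vf; have vu := monomial_unit vf.
apply/matrixP => r k; case: (vf) => winj x0 _.
have -> : r = w (invF winj r) by rewrite f_invF.
have -> : k = w (invF winj k) by rewrite f_invF.
set r' := invF _ r; set k' := invF _ k; apply: (mulIf (x0 k')).
rewrite (monomial_conj _ _ _ vf) !root_eltE !(inj_eq winj).
have [->|] := eqVneq r' k'; have [->|] := eqVneq k' c'; rewrite ?andbF ?addr0 ?andbT.
- rewrite mulrDr mulrDl mulr1 mul1r; congr (_ + _).
  by case: eqP => [->|_]; rewrite ?mulr0 ?mul0r // divfK.
- by rewrite mulrC.
- by rewrite !add0r => _; case: eqP => [->|_]; rewrite ?mulr0 ?mul0r // divfK.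
- by move=> _ _; rewrite mulr0 mul0r.
Qed.

Lemma root_elt_unitriangular (i j : 'I_n) (t : F) : (i < j)%N -> unitriangular (root_elt i j t).
Proof.
move=> ij r c cr; rewrite root_eltE; case: andP => [[/eqP ri /eqP cj]|_].
  by move: cr; rewrite ri cj leqNgt ij.
by rewrite addr0.
Qed.

(* Clearing the entries of [u] above the diagonal column by column, from left to
   right, each step changes a single entry. *)
Lemma unitriangular_ind (P : 'M[F]_n -> Prop) :
  P 1%:M ->
  (forall u (i j : 'I_n) (t : F), (i < j)%N -> unitriangular u -> u i j = 0 ->
     P u -> P (u *m root_elt i j t)) ->
  forall u, unitriangular u -> P u.
Proof.
move=> P1 Pstep u.
pose A u := [set p : 'I_n * 'I_n | (p.1 < p.2)%N && (u p.1 p.2 != 0)].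
have [N] := ubnP #|A u|; elim: N => // N IH in u * => ltN uu.
case: (set_0Vmem (A u)) => [A0|[p0 p0A]].
  suff -> : u = 1%:M by [].
  apply/matrixP => r c; rewrite mxE; case: (leqP c r) => [/uu //|rc].
  have : (r, c) \notin A u by rewrite A0 finset.in_set0.
  rewrite inE /= rc /= negbK => /eqP->.
  by rewrite -(inj_eq val_inj) (ltn_eqF rc).
case: (@arg_minnP _ p0 (mem (A u)) (fun p => p.2)) => // -[i j] /=.
rewrite inE /= => /andP[ij uij] minj.
(* Right multiplication by x_ij(t) adds t times column [i] to column [j]. By the choice of [j],
   column [i] is that of the identity, so only the entry (i, j) changes. *)
have coli k : u k i = (k == i)%:R.
  case: (leqP i k) => [/uu //|ki]; rewrite -(inj_eq val_inj) (ltn_eqF ki).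
  apply/eqP/negPn/negP => uki; have := minj (k, i); rewrite inE /= ki uki => /(_ isT).
  by rewrite leqNgt ij.
pose u' : 'M[F]_n := \matrix_(r, c) if (r == i) && (c == j) then 0 else u r c.
have uu' : unitriangular u'.
  move=> r c cr; rewrite mxE; case: andP => [[/eqP ri /eqP cj]|_]; last exact: uu.
  by move: cr; rewrite ri cj leqNgt ij.
have uE : u = u' *m root_elt i j (u i j).
  apply/matrixP => r c; rewrite mxE.
  rewrite (eq_bigr (fun k => u' r k * (k == c)%:R + u' r k * (if (k == i) && (c == j) then u i j else 0)));
    last by move=> k _; rewrite root_eltE mulrDr.
  rewrite big_split /= (bigD1 c) //= eqxx mulr1 big1 ?addr0; last first.
    by move=> k /negbTE->; rewrite mulr0.
  rewrite (bigD1 i) //= eqxx big1 ?addr0; last by move=> k /negbTE->; rewrite mulr0.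
  rewrite /= !mxE (_ : i == j = false) ?andbF; last by rewrite -(inj_eq val_inj) (ltn_eqF ij).
  rewrite coli; have [->|ri] := eqVneq r i; have [->|cj] := eqVneq c j; rewrite /=.
  - by rewrite add0r mul1r.
  - by rewrite mulr0 addr0.
  - by rewrite mul0r addr0.
  - by rewrite mul0r addr0.
rewrite uE; apply: Pstep => //; first by rewrite mxE !eqxx.
rewrite ltnS in ltN; apply: IH => //; apply: leq_trans _ ltN.
apply: proper_card; apply/properP; split.
  apply/fintype.subsetP => -[r c]; rewrite !inE /= mxE => /andP[-> /=].
  by case: ifP => // _; rewrite eqxx.
by exists (i, j); rewrite !inE /= ?ij ?uij // mxE !eqxx.
Qed.

End Monomial.

(** * The character condition on the permutation and the values *)

Section Compatible.
Variables (F : finFieldType) (C : numClosedFieldType) (n l : nat) (mu : l.-tuple nat).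
Variables (psi : F -> C) (psi_mu : 'M[F]_n -> C).
Hypothesis psi_char : is_additive_character psi.
Hypothesis psi_nontrivial : exists t, psi t != 1%R.
Hypothesis psi_muP : is_psi_mu psi mu psi_mu.
Local Open Scope ring_scope.

(** The index pairs whose root subgroup carries the character [psi]; on the other root subgroups
    psi_mu is trivial. *)
Definition adjacent (c c' : nat) : bool := (c' == c.+1) && internal mu c.

Definition compatible (w : 'I_n -> 'I_n) (x : 'I_n -> F) : Prop :=
  forall c c' : 'I_n, (c < c')%N -> (w c < w c')%N ->
    adjacent c c' = adjacent (w c) (w c') /\ (adjacent c c' -> x c' = x c).

Lemma idempotent_eq1 (z : C) : z != 0 -> z = z * z -> z = 1.
Proof. by move=> z0 e; apply: (mulIf z0); rewrite mul1r -e. Qed.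

Lemma psi0 : psi 0 = 1.
Proof.
have [p0 pD] := psi_char; apply: idempotent_eq1 (p0 _) _.
by rewrite -pD addr0.
Qed.

Lemma psi_muE u : unitriangular u ->
  psi_mu u = \prod_(p : 'I_n * 'I_n) (if adjacent p.1 p.2 then psi (u p.1 p.2) else 1).
Proof.
have [mu0 muM muroot] := psi_muP.
have u1 : unitriangular (1%:M : 'M[F]_n) by move=> i j _; rewrite mxE.
move: u; apply: unitriangular_ind => [|u i j t ij uu uij IH].
  rewrite big1 => [|[i j] _ /=].
    by apply: idempotent_eq1; [exact: mu0|rewrite -muM // mulmx1].
  case: ifP => // /andP[/eqP ij _]; rewrite mxE -(inj_eq val_inj) /= ij.
  by rewrite (ltn_eqF (ltnSn _)) psi0.
rewrite muM //; last exact: root_elt_unitriangular.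
rewrite IH muroot // (bigD1 (i, j)) //= uij [RHS](bigD1 (i, j)) //=.
have rootE r c : (u *m root_elt i j t) r c = u r c + u r i * (if c == j then t else 0).
  rewrite mxE (eq_bigr (fun k => u r k * (k == c)%:R + u r k * (if (k == i) && (c == j) then t else 0)));
    last by move=> k _; rewrite root_eltE mulrDr.
  rewrite big_split /= (bigD1 c) //= eqxx mulr1 big1 ?addr0; last first.
    by move=> k /negbTE->; rewrite mulr0.
  rewrite (bigD1 i) //= eqxx big1 ?addr0 //.
  by move=> k /negbTE->; rewrite mulr0.
rewrite rootE uij uu // !eqxx mul1r add0r psi0 if_same mul1r mulrC -/(adjacent i j).
(* Apart from (i, j), the product changes only entries of column [j] in rows above [i], none of
   which is on the superdiagonal. *)
congr (_ * _); apply: eq_bigr => -[r c] /= ne.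
  case: ifP => // /andP[/eqP cr _]; congr psi; rewrite rootE.
  have [ecj|_] := eqVneq c j; last by rewrite mulr0 addr0.
  rewrite (uu r i); last by rewrite -ltnS -cr ecj.
  rewrite (_ : r == i = false) ?mul0r ?addr0 //.
  by apply/negP => /eqP eri; case/eqP: ne; rewrite eri ecj.
Qed.

Lemma N_mu_compatible v w x : has_monomial_form v w x ->
  (N_mu psi_mu v <-> compatible w x).
Proof.
move=> vf; have vu := monomial_unit vf; have [winj x0 _] := vf.
have [_ muM muroot] := psi_muP.
split=> [[_ _ vN] c c' cc' wcc'|cw].
  have root_eq t : (if adjacent c c' then psi t else 1) =
                   (if adjacent (w c) (w c') then psi (x c * t / x c') else 1).
    rewrite -(muroot c c') // -(muroot (w c) (w c')) // -(monomial_conj_root _ _ _ vf).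
    apply: vN; first exact: root_elt_unitriangular.
    by rewrite (monomial_conj_root _ _ _ vf); exact: root_elt_unitriangular.
  have [t0 pt0] := psi_nontrivial.
  (* If only one of the two pairs were adjacent, [psi] would be trivial, since t -> x_c t / x_c' is
     onto. *)
  have eadj : adjacent c c' = adjacent (w c) (w c').
    have := root_eq t0; have := root_eq (x c' * t0 / x c).
    rewrite (_ : x c * (x c' * t0 / x c) / x c' = t0); last first.
      by rewrite mulrCA divff // mulr1 mulrC mulKf.
    case: (adjacent c c'); case: (adjacent (w c) (w c')) => // h1 h2.
      by rewrite h2 eqxx in pt0.
    by rewrite -h1 eqxx in pt0.
  split=> // adj; rewrite -eadj adj in root_eq.
  apply/eqP; rewrite -subr_eq0; apply/negPn/negP => xne.
  have [p0 pD] := psi_char; case/negP: pt0; apply/eqP.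
  (* By [root_eq], [psi] is 1 at every s - x_c s / x_c' = s (x_c' - x_c) / x_c'; this [s] makes that
     element equal to [t0]. *)
  pose s := x c' * t0 / (x c' - x c).
  have -> : t0 = s - x c * s / x c'.
    rewrite [x c * s]mulrC -mulrA -{1}[s]mulr1 -mulrBr -(divff (x0 c')) -mulrBl.
    by rewrite /s mulrA divfK // mulrC mulKf.
  apply: (mulIf (p0 (x c * s / x c'))); rewrite -pD subrK mul1r; exact: root_eq.
split=> //; first by apply/monomial_formP; exists w, x.
move=> u uu uy; set y := v *m u *m invmx v in uy *.
(* Reindexing by [w] compares the two products factor by factor. Where [w] reverses a pair, one of
   the matrices has a zero below its diagonal, the corresponding entry of the other vanishes too,
   and [psi 0] is 1. *)
rewrite !psi_muE // [RHS](reindex (fun p => (w p.1, w p.2))) /=; last first.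
  exists (fun p => (invF winj p.1, invF winj p.2)) => -[a b] _ /=.
    by rewrite !invF_f.
  by rewrite !f_invF.
apply: eq_bigr => -[c c'] _ /=; have := monomial_conj u c c' vf; rewrite -/y => yE.
have wlt a b : (w a < w b)%N || (w b < w a)%N || (a == b).
  by rewrite -(inj_eq winj) -(inj_eq val_inj) /=; case: ltngtP.
have adjlt (a b : 'I_n) : adjacent a b -> (a < b)%N by case/andP => /eqP->.
have [adj|nadj] := boolP (adjacent c c').
  have cc' := adjlt _ _ adj; have [wcc'|le] := ltnP (w c) (w c').
    have [e ex] := cw _ _ cc' wcc'; rewrite -e adj; congr psi.
    by apply: (mulIf (x0 c')); rewrite yE ex // mulrC.
  have -> : adjacent (w c) (w c') = false.
    by apply/negP => /adjlt; rewrite ltnNge le.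
  have y0 : y (w c) (w c') = 0.
    rewrite uy // (inj_eq winj) -(inj_eq val_inj) /=.
    by rewrite (ltn_eqF cc').
  move: yE; rewrite y0 mul0r => /esym/eqP; rewrite mulf_eq0 (negbTE (x0 c)) /= => /eqP->.
  exact: psi0.
have [adj'|//] := boolP (adjacent (w c) (w c')).
have wcc' := adjlt _ _ adj'; have [cc'|le] := ltnP c c'.
  by have [e _] := cw _ _ cc' wcc'; rewrite e adj' in nadj.
have u0 : u c c' = 0.
  rewrite uu // (_ : c == c' = false) //; apply/negP => /eqP ecc.
  by rewrite ecc ltnn in wcc'.
move: yE; rewrite u0 mulr0 => /eqP; rewrite mulf_eq0 (negbTE (x0 c')) orbF => /eqP->.
by rewrite psi0.
Qed.

End Compatible.

(** * The bijection between M_mu and N_mu *)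

Section VMatrix.
Variables (F : finFieldType) (n l : nat) (mu : l.-tuple nat).
Hypothesis sum_mu : sumn mu = n.
Implicit Types a : 'M[{poly F}]_l.
Local Open Scope ring_scope.

(* Column [c] lies in the block [(i, j)], and [r] is the row of its nonzero entry. *)
Record position a (c r : nat) (i j : 'I_l) (q e e' : nat) : Prop := Position {
  position_lt : (q < pdeg (a i j))%N;
  position_col : c = (coff mu (fun i j => pdeg (a i j)) i j + q)%N;
  position_run : is_run (a i j) q e e';
  position_end : (e' <= pdeg (a i j))%N;
  position_row :
    (r + e + e' = coff mu (fun j i => pdeg (a i j)) j i + pdeg (a i j) + q)%N
}.

Lemma M_mu_colsum a : M_mu mu a ->
  forall j, (\sum_i pdeg (a i j))%N = tnth mu j.
Proof. by case. Qed.

Lemma M_mu_rowsum a : M_mu mu a ->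
  forall i, (\sum_j pdeg (a i j))%N = tnth mu i.
Proof. by case. Qed.

Lemma position_row_local a c r i j q e e' : position a c r i j q e e' ->
  exists p, [/\ (p < pdeg (a i j))%N,
    r = (coff mu (fun j i => pdeg (a i j)) j i + p)%N &
    (p + e + e' = pdeg (a i j) + q)%N].
Proof.
move=> [qd _ [qr _ _ _] e'd er].
exists (pdeg (a i j) + q - e - e')%N; split; lia.
Qed.

Lemma position_exists a c : M_mu mu a -> (c < n)%N ->
  exists r i j q e e', position a c r i j q e e' /\ (r < n)%N.
Proof.
move=> Ma cn; have [ma a0 _ _] := Ma.
have [i [j [q [qd ec]]]] := coff_exists sum_mu (M_mu_colsum Ma) cn.
have [e [e' [re e'd]]] := run_exists (ma i j) (a0 i j) qd.
pose r := (coff mu (fun j i => pdeg (a i j)) j i + (pdeg (a i j) + q - e - e'))%N.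
have pos : position a c r i j q e e'.
  by split=> //; rewrite /r; case: re => *; lia.
exists r, i, j, q, e, e'; split=> //.
have [p [pd -> _]] := position_row_local pos.
exact: (in_block_ltn sum_mu (coff_in_block (M_mu_rowsum Ma) pd)).
Qed.

Lemma v_mx_position a (r c : 'I_n) r0 i j q e e' :
  M_mu mu a -> position a c r0 i j q e e' ->
  v_mx n mu a r c = if r == r0 :> nat then (a i j)`_e else 0.
Proof.
move=> Ma [qd ec re e'd er0]; have [ma a0 _ _] := Ma.
have cs := M_mu_colsum Ma.
have colz i' j' (q' : 'I_(pdeg (a i' j'))) : c = (col_offset mu a i' j' + q')%N :> nat ->
    [/\ i = i', j = j' & q = q'].
  by rewrite ec => /(coff_inj cs qd (ltn_ord q')).
rewrite mxE (bigD1 i) //= [X in _ + X]big1 ?addr0 => [|i' ne]; last first.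
  rewrite big1 // => j' _; rewrite big1 // => p _; rewrite big1 // => q' /eqP/colz[ei _ _].
  by rewrite ei eqxx in ne.
rewrite (bigD1 j) //= [X in _ + X]big1 ?addr0 => [|j' ne]; last first.
  rewrite big1 // => p _; rewrite big1 // => q' /eqP/colz[_ ej _].
  by rewrite ej eqxx in ne.
have inner (p : 'I_(pdeg (a i j))) :
   \sum_(q' < pdeg (a i j) | c == (col_offset mu a i j + q')%N :> nat) v_poly (a i j) p q'
   = if (p + e + e' == pdeg (a i j) + q)%N then (a i j)`_e else 0.
  rewrite (big_pred1 (Ordinal qd)).
    by rewrite (@v_polyE _ _ p (Ordinal qd) e e' (a0 i j) re e'd) mulrb.
  move=> q'; apply/eqP/eqP => [/colz[_ _ eq]|->]; first exact: val_inj.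
  by rewrite ec.
rewrite (eq_bigr _ (fun p _ => inner p)).
case: eqP => er; last first.
  rewrite big1 // => p /eqP erp; case: eqP => // ep; case: er; rewrite erp.
  by move: er0; rewrite -[row_offset _ _ _ _]/(coff mu (fun j i => pdeg (a i j)) j i); lia.
have [p [pd erp ep]] : exists p, [/\ (p < pdeg (a i j))%N,
    r0 = (row_offset mu a i j + p)%N & (p + e + e' = pdeg (a i j) + q)%N].
  by apply: (@position_row_local a c r0 i j q e e').
rewrite (big_pred1 (Ordinal pd)) /= ?ep ?eqxx // => p'.
by rewrite er erp eqn_add2l eq_sym.
Qed.

(** Moving right within a part of columns weakly lowers the index i, while moving down weakly raises
    it. So two entries in increasing position that share a part of columns, or likewise of rows, lie
    in one block, where runs can be compared. *)
Lemma position_compare a c r i j q e e' c2 r2 i2 j2 q2 e2 e2' : M_mu mu a ->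
  position a c r i j q e e' -> position a c2 r2 i2 j2 q2 e2 e2' ->
  (c < c2)%N -> (r < r2)%N ->
  adjacent mu c c2 = adjacent mu r r2 /\
  (adjacent mu c c2 -> (a i2 j2)`_e2 = (a i j)`_e).
Proof.
move=> Ma P1 P2 cc rr; have cs := M_mu_colsum Ma; have rs := M_mu_rowsum Ma.
have [p [pd er ep]] := position_row_local P1.
have [p2 [pd2 er2 ep2]] := position_row_local P2.
have [qd ec re e'd _] := P1; have [qd2 ec2 re2 e'd2 _] := P2.
have lc : (coff mu (fun i j => pdeg (a i j)) i j + q <=
           coff mu (fun i j => pdeg (a i j)) i2 j2 + q2)%N by rewrite -ec -ec2 ltnW.
have lr : (coff mu (fun j i => pdeg (a i j)) j i + p <=
           coff mu (fun j i => pdeg (a i j)) j2 i2 + p2)%N by rewrite -er -er2 ltnW.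
have {}lc := coff_lt cs qd qd2 lc.
have {}lr := coff_lt (d := fun j i => pdeg (a i j)) rs pd pd2 lr.
have bc : in_block mu j c by rewrite ec; exact: coff_in_block cs qd.
have bc2 : in_block mu j2 c2 by rewrite ec2; exact: coff_in_block cs qd2.
have br : in_block mu i r.
  by rewrite er; exact: (coff_in_block (d := fun j i => pdeg (a i j)) rs pd).
have br2 : in_block mu i2 r2.
  by rewrite er2; exact: (coff_in_block (d := fun j i => pdeg (a i j)) rs pd2).
have same : adjacent mu c c2 || adjacent mu r r2 -> i = i2 /\ j = j2.
  case/orP => /andP[/eqP e1].
    rewrite (internal_block bc) -e1 => bc'; have ej := in_block_inj bc' bc2.
    split=> //; case: lr lc => [h|[//]] [h'|[_ [h'|[]//]]]; last by lia.
    by move: h'; rewrite ej ltnn.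
  rewrite (internal_block br) -e1 => br'; have ei := in_block_inj br' br2.
  split=> //; case: lc lr => [h|[//]] [h'|[_ [h'|[]//]]]; last by lia.
  by move: h'; rewrite ei ltnn.
have [|] := boolP (adjacent mu c c2 || adjacent mu r r2); last first.
  by rewrite negb_or => /andP[/negbTE-> /negbTE->].
move=> /same[ei ej]; move: P2 pd2 er2 ep2 qd2 ec2 re2 bc2 br2 {e'd2 lc lr same}.
rewrite -{i2}ei -{j2}ej => P2 pd2 er2 ep2 qd2 ec2 re2 bc2 br2.
have qq : (q < q2)%N by lia.
case: (run_compare_pos re re2 qq ep ep2) => [|[eqp ee]]; first by lia.
split; last by rewrite ee.
rewrite /adjacent (internal_block bc) (internal_block br).
have [e1|ne] := eqVneq c2 c.+1.
  have e2r : r2 = r.+1 by lia.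
  by rewrite -e1 -e2r eqxx bc2 br2.
by rewrite (_ : r2 == r.+1 = false) //; lia.
Qed.

Lemma position_inj a c c2 r i j q e e' i2 j2 q2 e2 e2' : M_mu mu a ->
  position a c r i j q e e' -> position a c2 r i2 j2 q2 e2 e2' -> c = c2.
Proof.
move=> Ma P1 P2; have rs := M_mu_rowsum Ma.
have [p [pd er ep]] := position_row_local P1.
have [p2 [pd2 er2 ep2]] := position_row_local P2.
have [ej ei epp] : [/\ j = j2, i = i2 & p = p2].
  by apply: (coff_inj (d := fun j i => pdeg (a i j)) rs pd pd2); rewrite -er -er2.
have [_ -> re _ _] := P1; have [_ -> re2 _ _] := P2.
move: pd2 ep2 re2 {P1 P2 er2}; rewrite -{i2}ei -{j2}ej -{p2}epp => pd2 ep2 re2.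
congr addn; have [lt|lt|//] := ltngtP q q2.
  by case: (run_compare_pos re re2 lt ep ep2); lia.
by case: (run_compare_pos re2 re lt ep2 ep); lia.
Qed.

Lemma v_mx_compatible a : M_mu mu a -> exists w x,
  has_monomial_form (v_mx n mu a) w x /\ compatible mu w x.
Proof.
move=> Ma.
have pos (c : 'I_n) : exists rx : 'I_n * F, exists i j q e e',
    position a c rx.1 i j q e e' /\ rx.2 = (a i j)`_e.
  have [r [i [j [q [e [e' [pos rn]]]]]]] := position_exists Ma (ltn_ord c).
  by exists (Ordinal rn, (a i j)`_e), i, j, q, e, e'.
have [wx wxP] := fin_all_exists pos.
exists (fun c => (wx c).1), (fun c => (wx c).2); split.
  split=> [c c' ec|c|r c].
  - have [i [j [q [e [e' [P1 _]]]]]] := wxP c.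
    have [i2 [j2 [q2 [e2 [e2' [P2 _]]]]]] := wxP c'.
    by rewrite -ec in P2; apply/val_inj; apply: (position_inj Ma P1 P2).
  - by have [i [j [q [e [e' [[_ _ [_ fe _ _] _ _] ->]]]]]] := wxP c.
  - have [i [j [q [e [e' [P1 ->]]]]]] := wxP c.
    by rewrite (v_mx_position _ Ma P1).
move=> c c' cc ww.
have [i [j [q [e [e' [P1 ->]]]]]] := wxP c.
have [i2 [j2 [q2 [e2 [e2' [P2 ->]]]]]] := wxP c'.
exact: position_compare Ma P1 P2 cc ww.
Qed.

Lemma coff_le (d : 'I_l -> 'I_l -> nat) i j : (forall j, \sum_i d i j = tnth mu j)%N ->
  (coff mu d i j + d i j <= n)%N.
Proof.
move=> cs; apply: leq_trans (psum_le_n sum_mu j).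
rewrite /coff -addnA leq_add2l -cs.
rewrite [X in (_ <= X)%N](bigID (fun k : 'I_l => i < k)%N) /= leq_add2l.
by rewrite (bigD1 i) ?ltnn //= leq_addr.
Qed.

(** The right-hand side mentions only the matrix v_a, so equal matrices have equal degrees and hence
    equal block offsets. *)
Lemma pdeg_v_mx a i j : M_mu mu a ->
  pdeg (a i j) = #|[set c : 'I_n | in_block mu j c &&
    [exists r : 'I_n, (v_mx n mu a r c != 0) && in_block mu i r]]|.
Proof.
move=> Ma; have cs := M_mu_colsum Ma; have rs := M_mu_rowsum Ma.
set co := coff mu (fun i j => pdeg (a i j)) i j.
have con : (co + pdeg (a i j) <= n)%N := coff_le i j cs.
rewrite -[LHS](addKn co) -(card_ord_interval co con).
apply: eq_card => c; rewrite !inE.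
have [r [i2 [j2 [q [e [e' [P1 rn]]]]]]] := position_exists Ma (ltn_ord c).
have [p [pd er ep]] := position_row_local P1; have [qd ec re _ _] := P1.
have bc : in_block mu j2 c by rewrite ec; exact: coff_in_block cs qd.
have br : in_block mu i2 r.
  by rewrite er; exact: (coff_in_block (d := fun j i => pdeg (a i j)) rs pd).
apply/idP/andP => [/andP[c1 c2]|[bjc /existsP[r' /andP[]]]].
  have qd' : (c - co < pdeg (a i j))%N by lia.
  have [ei ej _] : [/\ i2 = i, j2 = j & q = c - co]%N.
    by apply: (coff_inj cs qd qd'); rewrite -ec -/co subnKC.
  split; first by rewrite -ej.
  apply/existsP; exists (Ordinal rn).
  rewrite (v_mx_position _ Ma P1) /= eqxx -ei br andbT.
  by case: re.
rewrite (v_mx_position _ Ma P1); case: (eqVneq (r' : nat) r) => [er' _ bir|_]; last by rewrite eqxx.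
rewrite er' in bir.
by rewrite /co (in_block_inj bir br) (in_block_inj bjc bc) ec leq_addr ltn_add2l.
Qed.

Lemma v_mx_inj a a' : M_mu mu a -> M_mu mu a' -> v_mx n mu a = v_mx n mu a' -> a = a'.
Proof.
move=> Ma Ma' ev; have [ma a0 _ _] := Ma; have [ma' a0' _ _] := Ma'.
have ed i j : pdeg (a i j) = pdeg (a' i j) by rewrite !pdeg_v_mx // ev.
apply/matrixP => i j; apply: poly_eq_of_runs => // q e e' e2 e2' qd r1 r2.
have cs := M_mu_colsum Ma; have rs := M_mu_rowsum Ma.
have ecof : coff mu (fun i j => pdeg (a i j)) = coff mu (fun i j => pdeg (a' i j)).
  by congr coff; apply/funext => i'; apply/funext => j'.
have erof : coff mu (fun j i => pdeg (a i j)) = coff mu (fun j i => pdeg (a' i j)).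
  by congr coff; apply/funext => i'; apply/funext => j'.
have nz_le (f : {poly F}) k : f`_k != 0 -> (k <= pdeg f)%N.
  rewrite leqNgt => fk; apply: contra fk => h.
  by rewrite nth_default //; apply: leq_trans (leqSpred _) h.
have e'd : (e' <= pdeg (a i j))%N by apply: nz_le; case: r1.
have e2'd : (e2' <= pdeg (a' i j))%N by apply: nz_le; case: r2.
set co := coff mu (fun i j => pdeg (a i j)) i j.
set ro := coff mu (fun j i => pdeg (a i j)) j i.
have cn : (co + q < n)%N := in_block_ltn sum_mu (coff_in_block cs qd).
pose p := (pdeg (a i j) + q - e - e')%N.
have pd : (p < pdeg (a i j))%N by case: r1 => *; rewrite /p; lia.
have rn : (ro + p < n)%N.
  exact: (in_block_ltn sum_mu (coff_in_block (d := fun j i => pdeg (a i j)) rs pd)).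
have P1 : position a (Ordinal cn) (ro + p) i j q e e'.
  by split=> //; rewrite -/ro /p; case: r1 => *; lia.
pose p2 := (pdeg (a i j) + q - e2 - e2')%N.
have P2 : position a' (Ordinal cn) (ro + p2) i j q e2 e2'.
  split=> //; [by rewrite -ed|by rewrite -ecof|].
  rewrite -erof -ed -/ro /p2; rewrite -ed in e2'd; case: r2 => *; lia.
(* The entry in row [ro + p] is nonzero for [a], hence for [a'], which forces [p = p2] and thus
   equal sums of exponents. *)
have := v_mx_position (Ordinal rn) Ma P1; rewrite ev (v_mx_position _ Ma' P2) /= eqxx.
rewrite eqn_add2l; case: eqP => [epp ->|_ /esym /eqP]; last by case: r1 => _ /negbTE->.
split=> //; move: epp; rewrite /p /p2; case: r1 => *; case: r2 => *.
by rewrite -ed in e2'd; lia.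
Qed.

End VMatrix.

(** * Every compatible monomial matrix is some v_a *)

Section VMatrixSurjective.
Variables (F : finFieldType) (n l : nat) (mu : l.-tuple nat).
Hypothesis sum_mu : sumn mu = n.
Local Open Scope ring_scope.

(** For neighbours in one part, either [f] reverses them, so that the part of the image weakly
    decreases, or [step] puts their images into one part. *)
Lemma block_monotone (b : 'I_n -> 'I_l) (f : 'I_n -> 'I_n) :
  (forall c : 'I_n, in_block mu (b c) c) ->
  (forall c c' : 'I_n, (c < c')%N -> (f c < f c')%N ->
     adjacent mu c c' -> adjacent mu (f c) (f c')) ->
  forall c c' : 'I_n, (c <= c')%N -> b c = b c' -> (b (f c') <= b (f c))%N.
Proof.
move=> bP step c c' le; have [m] := ubnP (c' - c)%N.
elim: m => // m IH in c' le *; move=> lem eb.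
have [ecc|ne] := eqVneq (c' : nat) c; first by rewrite (val_inj ecc).
have c2n : (c'.-1 < n)%N by have := ltn_ord c'; lia.
pose c2 := Ordinal c2n; have ec2 : c' = c2.+1 :> nat by rewrite /=; lia.
have bc2 : in_block mu (b c) c2.
  have := bP c; have := bP c'; rewrite -eb /in_block /= => /andP[_ h] /andP[h' _].
  by apply/andP; split; lia.
have eb2 : b c = b c2 := in_block_inj bc2 (bP c2).
apply: leq_trans (IH c2 _ _ eb2); try by rewrite /=; lia.
have adj : adjacent mu c2 c'.
  by rewrite /adjacent ec2 eqxx (internal_block bc2) -ec2 eb /=.
have [lt|ge] := ltnP (f c2) (f c').
  have lt2 : (c2 < c')%N by rewrite ec2.
  have /andP[/eqP e int] := step _ _ lt2 lt adj.
  rewrite (internal_block (bP (f c2))) -e in int.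
  by rewrite (in_block_inj int (bP (f c'))).
exact: in_block_le (bP _) (bP _) ge.
Qed.

Lemma sum_card_fiber (P : pred 'I_n) (g : 'I_n -> 'I_l) :
  (\sum_i #|[set c | P c && (g c == i)]| = #|[set c | P c]|)%N.
Proof.
rewrite -sum1dep_card (partition_big g predT) //=.
by apply: eq_bigr => i _; rewrite -sum1dep_card.
Qed.

Lemma v_mx_surj (v : 'M[F]_n) w x : has_monomial_form v w x -> compatible mu w x ->
  exists2 a, M_mu mu a & v_mx n mu a = v.
Proof.
move=> vf cw; have [winj x0 vE] := vf.
have [b bP] := fin_all_exists (fun c : 'I_n => in_block_exists sum_mu (ltn_ord c)).
pose w' := invF winj.
have ww' r : w (w' r) = r by rewrite /w' f_invF.
have w'w c : w' (w c) = c by rewrite /w' invF_f.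
(* By [pdeg_v_mx] these are the only possible degrees. *)
pose d i j := #|[set c | (b c == j) && (b (w c) == i)]|.
have dT j i : d i j = #|[set r | (b r == i) && (b (w' r) == j)]|.
  rewrite -(card_preimset _ winj); apply: eq_card => c.
  by rewrite !inE w'w andbC.
have bE c j : (b c == j) = in_block mu j c.
  by apply/eqP/idP => [<-//|h]; exact: in_block_inj (bP c) h.
have cs j : (\sum_i d i j)%N = tnth mu j.
  rewrite /d sum_card_fiber -(card_in_block sum_mu j).
  by apply: eq_card => c; rewrite !inE bE.
have rs i : (\sum_j d i j)%N = tnth mu i.
  rewrite (eq_bigr _ (fun j _ => dT j i)) sum_card_fiber -(card_in_block sum_mu i).
  by apply: eq_card => c; rewrite !inE bE.
(* The two directions of the equivalence in [compatible] give monotonicity along [w], for the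
   columns, and along its inverse, for the rows. *)
have posC c : (coff mu d (b (w c)) (b c) <= c <
               coff mu d (b (w c)) (b c) + d (b (w c)) (b c))%N.
  apply: (@coff_of_monotone n l mu sum_mu b (fun c => b (w c))) => //.
  apply: block_monotone => // k k' lt ltw adj.
  by have [<-] := cw _ _ lt ltw.
have posR r : (coff mu (fun j i => d i j) (b (w' r)) (b r) <= r <
               coff mu (fun j i => d i j) (b (w' r)) (b r) + d (b r) (b (w' r)))%N.
  apply: (@coff_of_monotone n l mu sum_mu b (fun r => b (w' r)) (fun j i => d i j)) => //.
  apply: block_monotone => // k k' lt ltw adj.
  by have [] := cw _ _ ltw; rewrite !ww' // => -> _.
(* [pf] and [xf] are the local row and the value of the nonzero entry in local column [q] of the
   block; the default values are never reached for q < d i j. *)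
pose pf i j q := if insub (coff mu d i j + q)%N is Some c
  then (w c - coff mu (fun j i => d i j) j i)%N else 0%N.
pose xf i j q := if insub (coff mu d i j + q)%N is Some c then x c else 1.
have key i j q : (q < d i j)%N -> exists c : 'I_n,
    [/\ c = (coff mu d i j + q)%N :> nat, b c = j, b (w c) = i &
     [/\ w c = (coff mu (fun j i => d i j) j i + pf i j q)%N :> nat,
         (pf i j q < d i j)%N & xf i j q = x c]].
  move=> qd; have cn := in_block_ltn sum_mu (coff_in_block cs qd).
  have [c ec] : exists c : 'I_n, c = (coff mu d i j + q)%N :> nat by exists (Ordinal cn).
  exists c; clear cn.
  have /andP[h1 h2] := posC c.
  have qd' : (c - coff mu d (b (w c)) (b c) < d (b (w c)) (b c))%N by lia.
  have [ei ej _] : [/\ b (w c) = i, b c = j & (c - coff mu d (b (w c)) (b c) = q)%N].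
    by apply: (coff_inj cs qd' qd); rewrite subnKC.
  have := posR (w c); rewrite w'w ei ej => /andP[r1 r2].
  by split=> //; rewrite /pf /xf -ec valK /=; split=> //; lia.
have fex (ij : 'I_l * 'I_l) : exists f : {poly F}, [/\ f \is monic, f.[0] != 0,
     pdeg f = d ij.1 ij.2 & forall q e e', (q < d ij.1 ij.2)%N -> is_run f q e e' ->
      (pf ij.1 ij.2 q + e + e' = d ij.1 ij.2 + q)%N /\ f`_e = xf ij.1 ij.2 q].
  case: ij => i j /=; apply: run_poly_exists.
  - move=> q qd; have [c [_ _ _ [_ -> ->]]] := key _ _ _ qd.
    by split=> //; exact: x0.
  - move=> q q' qd qd' e.
    have [c [ec _ _ [wc _ _]]] := key _ _ _ qd.
    have [c' [ec' _ _ [wc' _ _]]] := key _ _ _ qd'.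
    have : c = c' by apply/winj/val_inj; rewrite /= wc wc' e.
    by move/(congr1 val) => /=; rewrite ec ec' => /addnI.
  - move=> q qd; have qd' : (q < d i j)%N by lia.
    have [c [ec bc bw [wc _ xc]]] := key _ _ _ qd'.
    have [c' [ec' bc' bw' [wc' _ xc']]] := key _ _ _ qd.
    have [le|lt] := leqP (pf i j q.+1) (pf i j q).
      left; rewrite ltn_neqAle le andbT; apply/eqP => e.
      have : c = c' by apply/winj/val_inj; rewrite /= wc wc' e.
      by move/(congr1 val) => /=; rewrite ec ec'; lia.
    right; have cc' : (c < c')%N by lia.
    have wcc' : (w c < w c')%N by lia.
    have adj : adjacent mu c c'.
      rewrite /adjacent (internal_block (bP c)) bc (_ : c.+1 = c') ?eqxx; last by lia.
      by rewrite -bc' /=.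
    have [e ex] := cw _ _ cc' wcc'; rewrite xc xc' ex //; split=> //.
    by move: adj; rewrite e => /andP[/eqP e' _]; lia.
have [f fP] := fin_all_exists fex.
pose a : 'M[{poly F}]_l := \matrix_(i, j) f (i, j).
have da i j : pdeg (a i j) = d i j by rewrite mxE; have [] := fP (i, j).
have Ma : M_mu mu a.
  split=> [i j|i j|i|j].
  - by rewrite mxE; have [] := fP (i, j).
  - by rewrite mxE; have [] := fP (i, j).
  - by rewrite -rs; apply: eq_bigr => j _; exact: da.
  - by rewrite -cs; apply: eq_bigr => i _; exact: da.
exists a => //; apply/matrixP => r c.
set i := b (w c); set j := b c.
have /andP[c1 c2] := posC c; rewrite -/i -/j in c1 c2.
pose q := (c - coff mu d i j)%N; have qd : (q < d i j)%N by rewrite /q; lia.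
have [c3 [ec3 _ _ [wc _ xc]]] := key _ _ _ qd.
have e3 : c3 = c by apply: val_inj; rewrite /= ec3 /q; lia.
rewrite e3 {c3 ec3 e3} in wc xc.
have [ma a0 _ _] := Ma; have qda : (q < pdeg (a i j))%N by rewrite da.
have [e [e' [re e'd]]] := run_exists (ma i j) (a0 i j) qda.
have eco : coff mu (fun i j => pdeg (a i j)) = coff mu d.
  by congr coff; apply/funext => i'; apply/funext => j'.
have ero : coff mu (fun j i => pdeg (a i j)) = coff mu (fun j i => d i j).
  by congr coff; apply/funext => i'; apply/funext => j'.
have [_ _ _ /(_ q e e' qd)] := fP (i, j).
have fa : f (i, j) = a i j by rewrite mxE.
rewrite fa => /(_ re)[er ea].
have P1 : position mu a c (w c) i j q e e'.
  split=> //; first by rewrite eco subnKC.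
  by rewrite ero da wc; move: er => /= er; lia.
by rewrite (v_mx_position sum_mu r Ma P1) vE ea xc -(inj_eq val_inj).
Qed.

End VMatrixSurjective.

(** * Factorization and tableaux indexed by Phi *)

Section Factorization.
Variable F : finFieldType.
Local Open Scope ring_scope.
Implicit Types (f g : Phi F) (s t : seq (Phi F)) (p q : {poly F}).

Lemma PhiP f : [/\ val f \is monic, irreducible_poly (val f) & (val f).[0] != 0].
Proof. exact: (set_mem (valP f)). Qed.

Lemma Phi_pdeg_gt0 f : (0 < pdeg (val f))%N.
Proof. by have [_ [+ _] _] := PhiP f; rewrite /pdeg; case: size => [|[]]. Qed.

Lemma Phi_coprime f g : f != g -> coprimep (val f) (val g).
Proof.
have [mf irf _] := PhiP f; have [mg [_ irg] _] := PhiP g.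
rewrite irreducible_poly_coprime // => /eqP fg; apply/negP => dv; apply: fg.
apply/val_inj/eqP; rewrite -eqp_monic //; apply: irg dv.
by case: irf => sf _; rewrite neq_ltn sf orbT.
Qed.

Lemma Phi_prod_monic s : \prod_(g <- s) val g \is monic.
Proof. by apply: monic_prod => g _; have [] := PhiP g. Qed.

Lemma Phi_prod_horner0 s : (\prod_(g <- s) val g).[0] != 0.
Proof.
rewrite horner_prod prodf_seq_neq0; apply/allP => g _ /=.
by have [] := PhiP g.
Qed.

Lemma pdeg_monicM p q : p \is monic -> q \is monic ->
  pdeg (p * q) = (pdeg p + pdeg q)%N.
Proof.
move=> mp mq; rewrite /pdeg size_monicM ?monic_neq0 //.
have := monic_neq0 mp; have := monic_neq0 mq; rewrite -!size_poly_gt0; lia.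
Qed.

Lemma pdeg_Phi_prod s : pdeg (\prod_(g <- s) val g) = (\sum_(g <- s) pdeg (val g))%N.
Proof.
elim: s => [|g s IH]; first by rewrite !big_nil /pdeg size_poly1.
rewrite !big_cons pdeg_monicM ?IH ?Phi_prod_monic //.
by have [] := PhiP g.
Qed.

Lemma pdeg_Phi_prod_count s t : uniq t -> {subset s <= t} ->
  pdeg (\prod_(g <- s) val g) = (\sum_(f <- t) pdeg (val f) * count_mem f s)%N.
Proof.
move=> ut; rewrite pdeg_Phi_prod; elim: s => [|g s IH] st.
  by rewrite big_nil big1 // => f _; rewrite muln0.
rewrite big_cons IH; last by move=> f fs; apply: st; rewrite inE fs orbT.
rewrite [RHS](eq_bigr (fun f => pdeg (val f) * (g == f) + pdeg (val f) * count_mem f s)%N);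
  last by move=> f _; rewrite /= mulnDr.
rewrite big_split /=; congr addn; rewrite (bigD1_seq g) //=; last by apply: st; exact: mem_head.
rewrite eqxx muln1 big1 ?addn0 // => f; rewrite eq_sym => /negbTE->.
exact: muln0.
Qed.

(** Distinct elements of Phi are coprime, so the product is a power of f times a factor that f does
    not divide. *)
Lemma pmult_Phi_prod f s : pmult (val f) (\prod_(g <- s) val g) = count_mem f s.
Proof.
have [mf irf _] := PhiP f.
have fn0 k : val f ^+ k != 0 by apply: monic_neq0; exact: monic_exp.
have [r [er nr]] : exists r, \prod_(g <- s) val g = val f ^+ count_mem f s * r /\
    ~~ (val f %| r).
  elim: s => [|g s [r [er nr]]].
    exists 1; rewrite big_nil mulr1; split=> //.
    by rewrite dvdp1 neq_ltn; case: irf => ->; rewrite orbT.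
  rewrite big_cons er /=; have [->|fg] := eqVneq g f.
    by exists r; rewrite exprD expr1 mulrA.
  exists (val g * r); rewrite add0n mulrCA; split=> //.
  by rewrite Gauss_dvdpr // Phi_coprime // eq_sym.
have pn0 := monic_neq0 (Phi_prod_monic s).
have dvE k : (val f ^+ k %| \prod_(g <- s) val g) = (k <= count_mem f s)%N.
  rewrite er; case: leqP => [le|lt]; first by apply: dvdp_mulr; apply: dvdp_exp2l.
  apply/negP; rewrite -(subnKC lt) addSnnS exprD dvdp_mul2l // => dv.
  by case/negP: nr; apply: dvdp_trans dv; rewrite exprS dvdp_mulr.
rewrite /pmult; apply/eqP; rewrite eqn_leq; apply/andP; split.
  by apply/bigmax_leqP => k; rewrite dvE.
(* The maximum defining [pmult] runs over exponents below the size of the polynomial; the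
   multiplicity is in this range because f has positive degree. *)
have csz : (count_mem f s < size (\prod_(g <- s) val g)%R)%N.
  have := dvdp_leq pn0 (etrans (dvE _) (leqnn _)).
  have d0 := Phi_pdeg_gt0 f.
  have -> : size (val f ^+ count_mem f s) = (pdeg (val f) * count_mem f s).+1.
    by have := fn0 (count_mem f s); rewrite -size_poly_gt0 -size_exp; case: size.
  by apply: leq_trans; rewrite ltnS leq_pmull.
by apply: (bigop.bigmax_sup (Ordinal csz)); rewrite ?dvE /=.
Qed.

Lemma factorization p : p \is monic -> p.[0] != 0 ->
  exists s, p = \prod_(g <- s) val g.
Proof.
have [N] := ubnP (size p); elim: N => // N IH in p *; rewrite ltnS => sp mp p0.
have [sz1|szn1] := eqVneq (size p) 1%N.
  exists [::]; rewrite big_nil; apply/eqP; rewrite -eqp_monic ?monic1 //.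
  by rewrite -size_poly_eq1 sz1.
have pn0 := monic_neq0 mp.
have [ir|nir] := pselect (irreducible_poly p).
  have fp : Phi F p by split.
  by exists [:: SigSub (mem_set fp)]; rewrite big_seq1.
have [q [sq qp nqp]] : exists q, [/\ size q != 1%N, q %| p & ~~ (q %= p)].
  apply: contrapT => nex; apply: nir; split.
    by move: pn0 szn1; rewrite -size_poly_gt0; case: size => [|[]].
  move=> q sq qp; apply/negPn/negP => nqp; apply: nex.
  by exists q.
have qn0 : q != 0 by apply: contraNneq pn0 => q0; rewrite -dvd0p -q0.
have lq0 : lead_coef q != 0 by rewrite lead_coef_eq0.
(* A proper divisor is normalized, so that both it and its cofactor are monic and the induction
   applies to them. *)
pose q1 := (lead_coef q)^-1 *: q.
have mq1 : q1 \is monic by rewrite monicE lead_coefZ mulVf.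
have eq1 : q1 %= q by rewrite eqp_scale // invr_eq0.
have q1p : q1 %| p by rewrite (eqp_dvdl _ eq1).
have ep := divpK q1p; set r := p %/ q1 in ep.
have mr : r \is monic by rewrite -(monicMr r mq1) ep.
have [r0 q0] : r.[0] != 0 /\ q1.[0] != 0.
  by apply/andP; rewrite -negb_or -mulf_eq0 -hornerM ep.
have sq1 : size q1 != 1%N by rewrite (eqp_size eq1).
have sq1p : (size q1 < size p)%N.
  rewrite ltn_neqAle dvdp_leq // andbT dvdp_size_eqp //.
  by apply: contra nqp; apply: eqp_trans; rewrite eqp_sym.
have srp : (size r < size p)%N.
  rewrite -ep size_monicM ?monic_neq0 //.
  have := monic_neq0 mr; have := monic_neq0 mq1; rewrite -!size_poly_gt0.
  by move: sq1; move: (size q1) (size r) => m k; case: m => [|[|m]] // _ _; rewrite addnS /= addnS ltnS leq_addr.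
have [s1 e1] := IH q1 (leq_trans sq1p sp) mq1 q0.
have [s2 e2] := IH r (leq_trans srp sp) mr r0.
by exists (s2 ++ s1); rewrite big_cat /= -e1 -e2.
Qed.

Lemma pmult_factors p : p \is monic -> p.[0] != 0 ->
  exists s, p = \prod_(g <- s) val g /\ forall f, pmult (val f) p = count_mem f s.
Proof.
move=> mp p0; have [s ->] := factorization mp p0.
by exists s; split=> // f; rewrite pmult_Phi_prod.
Qed.

Lemma eq_pmult p q : p \is monic -> p.[0] != 0 -> q \is monic -> q.[0] != 0 ->
  (forall f, pmult (val f) p = pmult (val f) q) -> p = q.
Proof.
move=> mp p0 mq q0 e; have [s [ps cs]] := pmult_factors mp p0.
have [t [qt ct]] := pmult_factors mq q0.
rewrite ps qt; apply: perm_big; apply/allP => f _ /=.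
by rewrite -cs -ct e.
Qed.

Lemma pmult_exists t (e : Phi F -> nat) : uniq t -> (forall f, f \notin t -> e f = 0%N) ->
  exists2 p, p \is monic /\ p.[0] != 0 & forall f, pmult (val f) p = e f.
Proof.
move=> ut et; pose s := flatten [seq nseq (e f) f | f <- t].
exists (\prod_(g <- s) val g); first by split; [exact: Phi_prod_monic|exact: Phi_prod_horner0].
move=> f; rewrite pmult_Phi_prod /s count_flatten -map_comp sumnE big_map.
have [ft|ft] := boolP (f \in t).
  rewrite (bigD1_seq f) //= count_nseq /= eqxx mul1n big1 ?addn0 // => g /negbTE gf.
  by rewrite count_nseq /= gf.
rewrite et // big1_seq // => g /= gt; rewrite count_nseq /=.
by case: eqP gt ft => // -> ->.
Qed.

Lemma pdeg_pmult p t : p \is monic -> p.[0] != 0 -> uniq t ->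
  (forall f, pmult (val f) p != 0%N -> f \in t) ->
  pdeg p = (\sum_(f <- t) pdeg (val f) * pmult (val f) p)%N.
Proof.
move=> mp p0 ut st; have [s [ps cs]] := pmult_factors mp p0.
rewrite {1}ps (pdeg_Phi_prod_count ut); first by apply: eq_bigr => f _; rewrite cs.
by move=> f fs; apply: st; rewrite cs -lt0n -has_count has_pred1.
Qed.

(** One finite list of irreducible factors for all entries turns every sum over Phi into a sum over
    this list. *)
Lemma pmult_support_mx l (a : 'M[{poly F}]_l) :
  (forall i j, a i j \is monic) -> (forall i j, (a i j).[0] != 0) ->
  exists t, uniq t /\ forall i j f, pmult (val f) (a i j) != 0%N -> f \in t.
Proof.
move=> ma a0.
have [s sP] := fin_all_exists (fun ij : 'I_l * 'I_l => pmult_factors (ma ij.1 ij.2) (a0 ij.1 ij.2)).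
exists (undup (flatten [seq s ij | ij <- enum {: 'I_l * 'I_l}])); split=> [|i j f].
  exact: undup_uniq.
have [_ /= ->] := sP (i, j); rewrite -lt0n -has_count has_pred1 mem_undup => fs.
by apply/flattenP; exists (s (i, j)) => //; apply: map_f; rewrite mem_enum.
Qed.

Lemma weight_seq (P : Phi_family F) t i : uniq t -> (forall f, P f != [::] -> f \in t) ->
  weight P i = (\sum_(f <- t) pdeg (val f) * count_mem i (flatten (P f)))%N.
Proof.
move=> ut Pt; rewrite /weight (fsbigE t) //; last first.
  move=> f _ /(contra (Pt f)); rewrite negbK => /eqP->; exact: muln0.
by apply: eq_bigl => f; rewrite in_setT.
Qed.

End Factorization.

(** * Families of tableaux and their weights *)

Section Tableaux.
Variables (F : finFieldType) (l : nat).
Implicit Types a : 'M[{poly F}]_l.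

Definition monic_mx a : Prop :=
  (forall i j, a i j \is monic) /\ (forall i j, (a i j).[0]%R != 0%R).

Lemma rsk0 : rsk (const_mx 0 : 'M[nat]_l) = ([::], [::]).
Proof.
rewrite rskE; suff -> : two_line_array (const_mx 0 : 'M[nat]_l) = [::] by [].
apply: size0nil; rewrite -count_predT count_two_line_array big1 // => i _.
by rewrite big1 // => j _; rewrite mxE.
Qed.

Lemma rsk_mult_mx_nil a (t : seq (Phi F)) : (forall i j f, pmult (val f) (a i j) != 0 -> f \in t) ->
  forall f, f \notin t -> rsk (mult_mx a (val f)) = ([::], [::]).
Proof.
move=> at0 f ft; rewrite -rsk0; congr rsk; apply/matrixP => i j; rewrite !mxE.
by apply/eqP/negPn; apply: contra ft => /at0.
Qed.

(** [P] collects the second letters j of the arrays, so its weight concerns the columns of [a];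
    summing d(f) times the multiplicities of f over all f gives back the degrees. *)
Lemma weight_P_Phi a k : monic_mx a ->
  weight (P_Phi a) k = \sum_(j < l | j == k :> nat) \sum_i pdeg (a i j).
Proof.
move=> [ma a0]; have [t [ut at0]] := pmult_support_mx ma a0.
rewrite (weight_seq _ ut) => [|f]; last first.
  by apply: contraNT => /(rsk_mult_mx_nil at0); rewrite /P_Phi => ->.
rewrite (eq_bigr (fun f => \sum_(j < l | j == k :> nat) \sum_i
    pdeg (val f) * pmult (val f) (a i j))) => [|f _]; last first.
  rewrite count_mem_rsk1 big_distrr; apply: eq_bigr => j _.
  by rewrite big_distrr; apply: eq_bigr => i _; rewrite mxE.
rewrite exchange_big; apply: eq_bigr => j _; rewrite exchange_big.
by apply: eq_bigr => i _; rewrite -pdeg_pmult //; exact: at0.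
Qed.

Lemma weight_Q_Phi a k : monic_mx a ->
  weight (Q_Phi a) k = \sum_(i < l | i == k :> nat) \sum_j pdeg (a i j).
Proof.
move=> [ma a0]; have [t [ut at0]] := pmult_support_mx ma a0.
rewrite (weight_seq _ ut) => [|f]; last first.
  by apply: contraNT => /(rsk_mult_mx_nil at0); rewrite /Q_Phi => ->.
rewrite (eq_bigr (fun f => \sum_(i < l | i == k :> nat) \sum_j
    pdeg (val f) * pmult (val f) (a i j))) => [|f _]; last first.
  rewrite count_mem_rsk2 big_distrr; apply: eq_bigr => i _.
  by rewrite big_distrr; apply: eq_bigr => j _; rewrite mxE.
rewrite exchange_big; apply: eq_bigr => i _; rewrite exchange_big.
by apply: eq_bigr => j _; rewrite -pdeg_pmult //; exact: at0.
Qed.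

Lemma sum_ord_eq_nth (mu : l.-tuple nat) (g : 'I_l -> nat) :
  (forall k, \sum_(j < l | j == k :> nat) g j = nth 0 mu k) <->
  (forall j, g j = tnth mu j).
Proof.
split=> [H j|H k].
  rewrite (tnth_nth 0) -H (big_pred1 j) // => j'.
have [kl|lk] := ltnP k l; last first.
  rewrite nth_default ?size_tuple // big_pred0 // => j.
  by apply/negbTE; rewrite neq_ltn (leq_trans (ltn_ord j) lk).
by rewrite (big_pred1 (Ordinal kl)) ?H ?(tnth_nth 0).
Qed.

Lemma tableau_pairs_M_mu (mu : l.-tuple nat) a : M_mu mu a ->
  tableau_pairs F mu (P_Phi a, Q_Phi a).
Proof.
move=> [ma a0 rs cs]; have mxa : monic_mx a by [].
have [t [ut at0]] := pmult_support_mx ma a0.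
have fin (P : Phi_family F) : (forall f, f \notin t -> P f = [::]) ->
    finite_set [set f | P f != [::]]%classic.
  move=> Pt; apply: sub_finite_set (finite_seq t) => f /=.
  by apply: contraNT => /Pt->.
split=> /=.
- split=> [f|]; first by have [] := rsk_column_strict (mult_mx a (val f)).
  by apply: fin => f ft; rewrite /P_Phi (rsk_mult_mx_nil at0).
- split=> [f|]; first by have [] := rsk_column_strict (mult_mx a (val f)).
  by apply: fin => f ft; rewrite /Q_Phi (rsk_mult_mx_nil at0).
- by move=> f; have [] := rsk_column_strict (mult_mx a (val f)).
- move=> k; rewrite weight_P_Phi //.
  by move: k; apply/(sum_ord_eq_nth mu (fun j => \sum_i pdeg (a i j))).
- move=> k; rewrite weight_Q_Phi //.
  by move: k; apply/(sum_ord_eq_nth mu (fun i => \sum_j pdeg (a i j))).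
Qed.

Lemma P_Q_Phi_inj a a' : monic_mx a -> monic_mx a' ->
  P_Phi a = P_Phi a' -> Q_Phi a = Q_Phi a' -> a = a'.
Proof.
move=> [ma a0] [ma' a0'] eP eQ; apply/matrixP => i j; apply: eq_pmult => // f.
suff : mult_mx a (val f) = mult_mx a' (val f) by move/matrixP/(_ i j); rewrite !mxE.
apply: rsk_inj; rewrite (surjective_pairing (rsk (mult_mx a _))).
rewrite (surjective_pairing (rsk (mult_mx a' _))).
by congr (_, _); [have := congr1 (@^~ f) eP|have := congr1 (@^~ f) eQ].
Qed.

(** An entry k >= l would contribute at least d(f) > 0 to a weight that is 0; inverting RSK with [l]
    rows and columns requires this bound. *)
Lemma has_weight_entries (P : Phi_family F) (mu : l.-tuple nat) :
  finite_set [set f | P f != [::]]%classic -> has_weight P mu ->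
  forall f, all (gtn l) (flatten (P f)).
Proof.
move=> /finite_seqP[s es] wP f; apply/allP => k kP /=; rewrite ltnNge; apply/negP => lk.
have st g : P g != [::] -> g \in undup s.
  rewrite mem_undup => Pg; have : [set f | P f != [::]]%classic g by [].
  by rewrite es.
have fs : f \in undup s by apply: st; apply: contraTneq kP => ->.
have := wP k; rewrite (weight_seq _ (undup_uniq s) st) nth_default ?size_tuple //.
rewrite (bigD1_seq f) ?undup_uniq //= => /eqP; rewrite addn_eq0 => /andP[+ _].
rewrite muln_eq0 => /orP[|].
  by have := Phi_pdeg_gt0 f; case: pdeg.
by rewrite -leqn0 leqNgt -has_count has_pred1 kP.
Qed.

Lemma tableau_pairs_surj (mu : l.-tuple nat) P Q : tableau_pairs F mu (P, Q) ->
  exists2 a, M_mu mu a & P_Phi a = P /\ Q_Phi a = Q.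
Proof.
move=> [/= [csP finP] [csQ finQ] sh wP wQ].
have bex f : exists b : 'M[nat]_l, rsk b = (P f, Q f).
  apply: rsk_surj => //; first exact: has_weight_entries finP wP f.
  exact: has_weight_entries finQ wQ f.
have [b bP] := choice bex.
have /finite_seqP[s es] := finP.
(* The matrices [b f] are only chosen to have image (P f, Q f); injectivity of RSK makes them vanish
   outside the finite support, as needed to form polynomials. *)
have b0 f : f \notin undup s -> b f = const_mx 0.
  rewrite mem_undup => fs; have Pf : P f = [::].
    apply/eqP/negPn/negP => Pf; have : [set f | P f != [::]]%classic f by [].
    by rewrite es /= (negbTE fs).
  apply: rsk_inj; rewrite rsk0 bP Pf.
  by have := sh f; rewrite /= Pf; case: (Q f).
have aex (ij : 'I_l * 'I_l) : exists p : {poly F}, (p \is monic /\ p.[0]%R != 0%R) /\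
    forall f, pmult (val f) p = b f ij.1 ij.2.
  have [|p h1 h2] := @pmult_exists F (undup s) (fun f => b f ij.1 ij.2) (undup_uniq s).
    by move=> f fs; rewrite b0 // mxE.
  by exists p.
have [g gP] := fin_all_exists aex.
pose a : 'M[{poly F}]_l := (\matrix_(i, j) g (i, j))%R.
have mxa : monic_mx a by split=> i j; rewrite mxE; have [[]] := gP (i, j).
have multE f : mult_mx a (val f) = b f.
  by apply/matrixP => i j; rewrite !mxE; have [_ ->] := gP (i, j).
have eP : P_Phi a = P by apply/funext => f; rewrite /P_Phi multE bP.
have eQ : Q_Phi a = Q by apply/funext => f; rewrite /Q_Phi multE bP.
exists a => //; have [ma a0] := mxa; split=> //.
  apply/(sum_ord_eq_nth mu (fun i => \sum_j pdeg (a i j))) => k.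
  by rewrite -weight_Q_Phi // eQ; exact: wQ.
apply/(sum_ord_eq_nth mu (fun j => \sum_i pdeg (a i j))) => k.
by rewrite -weight_P_Phi // eP; exact: wP.
Qed.

End Tableaux.

Local Open Scope ring_scope.

Theorem theorem5 (F : finFieldType) (C : numClosedFieldType) (psi : F -> C)
    (n l : nat) (mu : l.-tuple nat) (psi_mu : 'M[F]_n -> C)
    (psi_char : is_additive_character psi) (psi_nontrivial : exists t, psi t != 1)
    (mu_comp : is_composition n mu) (psi_muP : is_psi_mu psi mu psi_mu) :
  set_bij (N_mu psi_mu) (tableau_pairs F mu)
    (fun v : 'M[F]_n => (P_Phi (a_of mu v), Q_Phi (a_of mu v))).
Proof.
have [_ sum_mu] := mu_comp.
have NM v : N_mu psi_mu v -> exists2 a, M_mu mu a & v_mx n mu a = v.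
  move=> Nv; have [_ /monomial_formP[w [x vf]] _] := Nv.
  apply: (v_mx_surj sum_mu vf).
  exact/(N_mu_compatible psi_char psi_nontrivial psi_muP vf).
have MN a : M_mu mu a -> N_mu psi_mu (v_mx n mu a).
  move=> Ma; have [w [x [vf cw]]] := v_mx_compatible sum_mu Ma.
  exact/(N_mu_compatible psi_char psi_nontrivial psi_muP vf).
(* [a_of] picks some preimage of [v], so existence suffices here; its uniqueness enters below, to
   identify the preimage of v_a with a. *)
have aP v : N_mu psi_mu v -> M_mu mu (a_of mu v) /\ v_mx n mu (a_of mu v) = v.
  move=> /NM[a Ma va]; rewrite /a_of.
  exact: (xgetPex 0 (P := [set a | M_mu mu a /\ v_mx n mu a = v]%classic) (ex_intro _ a (conj Ma va))).
have mx (a : 'M[{poly F}]_l) : M_mu mu a -> monic_mx a by case.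
split.
- by move=> v /aP[Ma _]; exact: tableau_pairs_M_mu.
- move=> v v' /set_mem/aP[Ma va] /set_mem/aP[Ma' va'] [eP eQ].
  by rewrite -va -va' (P_Q_Phi_inj (mx _ Ma) (mx _ Ma') eP eQ).
- move=> [P Q] /tableau_pairs_surj[a Ma [eP eQ]].
  exists (v_mx n mu a); first exact: MN.
  have [Ma' va] := aP _ (MN _ Ma).
  by rewrite (v_mx_inj sum_mu Ma' Ma va) eP eQ.
Qed.
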